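(* Let $0\le g_1\in L^\infty(\Omega)$ and $0\le g_2\in L^{q}(\Omega)$ with $q=\frac{p}{p-1}$. If there exists $u\in W_0^{1,p}(\Omega)\cap L^\infty(\Omega)$ with $u\ge0$ in $\Omega$ such that $$J(u)=\int_\Omega H(\nabla u)^p\,dx+\iint_{\mathbb{R}^{2N}}|u(x)-u(y)|^p\,d\mu-\int_\Omega g_1(x)\,u^p\,dx<0,$$ then the problem $$-H_pv+(-\Delta_p)^sv-g_1(x)|v|^{p-2}v=g_2(x)\quad\text{in }\Omega$$ has no positive weak supersolution in $W_0^{1,p}(\Omega)$.
   Context: $\Omega\subset\mathbb{R}^N$, $N\ge2$, is a bounded $C^1$ domain, $1<p<\infty$, $0<s<1$, and $d\mu=|x-y|^{-N-ps}\,dx\,dy$. $H:\mathbb{R}^N\to[0,\infty)$ is a Finsler–Minkowski norm: $H\in C^1(\mathbb{R}^N\setminus\{0\})$; $H(x)=0$ iff $x=0$; $H(tx)=|t|H(x)$ for all $t\in\mathbb{R}$, $x\in\mathbb{R}^N$; there are constants $C_1,C_2>0$ with $C_1|x|\le H(x)\le C_2|x|$ for all $x$; and $H$ is strictly convex as a norm, i.e. $H(x+y)<H(x)+H(y)$ for linearly independent $x,y$. The vector field $H(\xi)^{p-1}\nabla H(\xi)$ is understood as $0$ at $\xi=0$. $H_pu=\mathrm{div}(H(\nabla u)^{p-1}\nabla H(\nabla u))$ and $(-\Delta_p)^su(x)=\mathrm{P.V.}\int_{\mathbb{R}^N}|u(x)-u(y)|^{p-2}(u(x)-u(y))|x-y|^{-N-ps}\,dy$.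 $W_0^{1,p}(\Omega)=\{u\in W^{1,p}(\mathbb{R}^N):u=0\text{ in }\mathbb{R}^N\setminus\Omega\}$. $v\in W_0^{1,p}(\Omega)$ is a weak supersolution of the problem if for every nonnegative $\phi\in W_0^{1,p}(\Omega)$ $$\int_\Omega H(\nabla v)^{p-1}\nabla H(\nabla v)\cdot\nabla\phi\,dx+\iint_{\mathbb{R}^{2N}}|v(x)-v(y)|^{p-2}(v(x)-v(y))(\phi(x)-\phi(y))\,d\mu-\int_\Omega g_1|v|^{p-2}v\,\phi\,dx\ge\int_\Omega g_2\,\phi\,dx.$$ It is positive if $v>0$ a.e. in $\Omega$. *)

(* Defs.v *)
From HB Require Import structures.
From mathcomp Require Import all_boot all_order all_algebra.
From mathcomp Require Import all_classical all_reals all_analysis.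

Set Implicit Arguments.
Unset Strict Implicit.
Unset Printing Implicit Defensive.

Import Order.TTheory GRing.Theory Num.Theory.
Import numFieldNormedType.Exports.

Local Open Scope classical_set_scope.
Local Open Scope ring_scope.

(** * Lebesgue measure on [R^n]

    [R^n] is ['rV[R]_n]. Its Borel sigma-algebra is generated by the
    coordinate maps, as the library does for [n.-tuple]. *)

Definition rV_display : measure_display.
Proof. exact: default_measure_display. Qed.

Section measurable_rV.
Context {R : realType} (n : nat).

Let coord (i : 'I_n) (x : 'rV[R]_n) : R := x 0 i.

Let rV_set0 : g_sigma_preimage coord set0.
Proof. exact: sigma_algebra0. Qed.

Let rV_setC A : g_sigma_preimage coord A -> g_sigma_preimage coord (~` A).
Proof. exact: sigma_algebraC. Qed.

Let rV_bigcup (F : (set 'rV[R]_n)^nat) :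
  (forall i, g_sigma_preimage coord (F i)) ->
  g_sigma_preimage coord (\bigcup_i (F i)).
Proof. exact: sigma_algebra_bigcup. Qed.

HB.instance Definition _ := @isMeasurable.Build rV_display
  'rV[R]_n (g_sigma_preimage coord) rV_set0 rV_setC rV_bigcup.

Lemma measurable_coord (i : 'I_n) :
  measurable_fun [set: 'rV[R]_n] (fun x : 'rV[R]_n => x 0 i).
Proof.
move=> _ Y mY; rewrite setTI; apply: sub_sigma_algebra => /=.
rewrite -bigcup_seq/=; exists i => /=; first by rewrite mem_index_enum.
by exists Y => //; rewrite setTI.
Qed.

Lemma measurable_fun_rVP d (T : measurableType d) (f : T -> 'rV[R]_n) :
  (forall i, measurable_fun [set: T] (fun t => f t 0 i)) ->
  measurable_fun [set: T] f.
Proof.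
move=> mf.
have sub : g_sigma_preimage (fun i => coord i \o f) `<=` measurable.
  apply: smallest_sub; first exact: sigma_algebra_measurable.
  rewrite -bigcup_seq; apply: bigcup_sub => i _.
  by move=> A [B mB <-]; exact: mf.
move=> _ A mA; apply: sub; rewrite g_sigma_preimage_comp.
by exists A.
Qed.

End measurable_rV.

Section cons_rV.
Context {R : realType} (n : nat).

Definition cons_rV (z : R * 'rV[R]_n) : 'rV[R]_n.+1 :=
  row_mx (z.1%:M : 'rV[R]_1) z.2.

Definition uncons_rV (x : 'rV[R]_n.+1) : R * 'rV[R]_n :=
  (x 0 ord0, @rsubmx R 1 1 n x).

Lemma cons_rVK : cancel cons_rV uncons_rV.
Proof.
move=> [a v]; rewrite /uncons_rV /cons_rV /= row_mxKr; congr pair.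
have e : ord0 = lshift n (0 : 'I_1) :> 'I_n.+1 by apply: val_inj.
have := @row_mxEl R 1 1 n a%:M v 0 0.
by rewrite [RHS]mxE eqxx mulr1n -e.
Qed.

Lemma measurable_cons_rV : measurable_fun [set: R * 'rV[R]_n] cons_rV.
Proof.
apply: measurable_fun_rVP => i; rewrite /cons_rV.
have [j ->|j ->] := @split_ordP 1 n i.
  rewrite (_ : (fun _ => _) = fst); first exact: measurable_fst.
  by apply/funext => t; rewrite [LHS](@row_mxEl R 1 1 n) mxE ord1 eqxx mulr1n.
rewrite (_ : (fun _ => _) = (fun x : 'rV[R]_n => x 0 j) \o snd).
  exact: (measurableT_comp (measurable_coord j) measurable_snd).
by apply/funext => t; rewrite [LHS](@row_mxEr R 1 1 n).
Qed.

Lemma measurable_uncons_rV : measurable_fun [set: 'rV[R]_n.+1] uncons_rV.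
Proof.
apply/measurable_fun_pairP; split; first exact: measurable_coord.
apply: measurable_fun_rVP => i.
under eq_fun do rewrite /= mxE.
exact: measurable_coord.
Qed.

Variable m : {sigma_finite_measure set 'rV[R]_n -> \bar R}.

Definition lebesgue_cons : set 'rV[R]_n.+1 -> \bar R :=
  pushforward (@lebesgue_measure R \x m)%E cons_rV.

Let pm : {measure set 'rV[R]_n.+1 -> \bar R}.
Proof.
unshelve refine (pushforward (@lebesgue_measure R \x m)%E cons_rV).
exact: measurable_cons_rV.
Defined.

Let lebesgue_cons0 : lebesgue_cons set0 = 0%E.
Proof. exact: (measure0 pm). Qed.

Let lebesgue_cons_ge0 A : (0 <= lebesgue_cons A)%E.
Proof. exact: (measure_ge0 pm). Qed.

Let lebesgue_cons_sigma_additive : semi_sigma_additive lebesgue_cons.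
Proof. exact: (@measure_semi_sigma_additive _ _ _ pm). Qed.

Lemma lebesgue_cons_sigma_finite : sigma_finite setT lebesgue_cons.
Proof.
have /sigma_finiteP[F [FT ndF Foo]] := sigma_finiteT (@lebesgue_measure R).
have /sigma_finiteP[G [GT ndG Goo]] := sigma_finiteT m.
exists (fun k => uncons_rV @^-1` (F k `*` G k)).
  apply/seteqP; split=> [x _|//].
  have [i _ Fi] : (\bigcup_k F k) (uncons_rV x).1 by rewrite -FT.
  have [j _ Gj] : (\bigcup_k G k) (uncons_rV x).2 by rewrite -GT.
  exists (maxn i j) => //; split.
    by move: Fi; apply/subsetPset/ndF/leq_maxl.
  by move: Gj; apply/subsetPset/ndG/leq_maxr.
move=> k; have [mF Fk] := Foo k; have [mG Gk] := Goo k; split.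
  by rewrite -[X in measurable X]setTI; apply: measurable_uncons_rV => //;
    exact: measurableX.
rewrite /lebesgue_cons /pushforward -comp_preimage.
rewrite (_ : uncons_rV \o cons_rV = id); last exact/funext/cons_rVK.
by rewrite preimage_id product_measure1E// lte_mul_pinfty// ge0_fin_numE.
Qed.

HB.instance Definition _ := isMeasure.Build _ _ _ lebesgue_cons
  lebesgue_cons0 lebesgue_cons_ge0 lebesgue_cons_sigma_additive.
HB.instance Definition _ := Measure_isSigmaFinite.Build _ _ _ lebesgue_cons
  lebesgue_cons_sigma_finite.

End cons_rV.

Fixpoint lebesgue_rV {R : realType} (n : nat) :
    {sigma_finite_measure set 'rV[R]_n -> \bar R} :=
  if n is n'.+1 then lebesgue_cons (lebesgue_rV n')
  else \d_(0 : 'rV[R]_0).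

Lemma lebesgue_rV_box {R : realType} (n : nat) (A : 'I_n -> set R) :
  (forall i, measurable (A i)) ->
  lebesgue_rV n [set x : 'rV[R]_n | forall i, A i (x 0 i)] =
  (\prod_(i < n) lebesgue_measure (A i))%E.
Proof.
elim: n A => [|n IH] A mA.
  rewrite big_ord0 /= diracE mem_set//; by case.
rewrite big_ord_recl /= -IH//.
have mB : measurable [set x : 'rV[R]_n | forall i, A (lift ord0 i) (x 0 i)].
  rewrite (_ : [set _ | _] = \bigcap_(i in [set: 'I_n])
      ((fun x : 'rV[R]_n => x 0 i) @^-1` A (lift ord0 i))); last first.
    by apply/seteqP; split=> x /= h i; [move=> _|]; exact: h.
  apply: fin_bigcap_measurable => // i _.
  by rewrite -[X in measurable X]setTI; exact: measurable_coord.
rewrite /lebesgue_cons /pushforward.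
apply: etrans (product_measure1E (@lebesgue_measure R) (lebesgue_rV n)
  (mA ord0) mB).
apply: (congr1 (@lebesgue_measure R \x lebesgue_rV n)%E).
apply/seteqP; split=> -[a v] /=.
  move=> h; split.
    have := h ord0; rewrite (_ : cons_rV _ _ _ = a)//.
    by have [] := cons_rVK (a, v).
  move=> i; have := h (lift ord0 i).
  by rewrite (_ : lift ord0 i = rshift 1 i) ?[cons_rV _ _ _](@row_mxEr R 1 1 n)//;
    exact: val_inj.
move=> [h0 h] i; have [j ->|j ->] := @split_ordP 1 n i.
  rewrite [cons_rV _ _ _](@row_mxEl R 1 1 n) mxE !ord1 eqxx mulr1n.
  by rewrite (_ : lshift n 0 = ord0)//; exact: val_inj.
rewrite [cons_rV _ _ _](@row_mxEr R 1 1 n).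
by rewrite (_ : rshift 1 j = lift ord0 j)//; exact: val_inj.
Qed.

(** * Calculus on [R^n] *)

Section calculus.
Context {R : realType} {n : nat}.
Implicit Types (f : 'rV[R]_n -> R) (x y : 'rV[R]_n).

Definition dotv x y : R := \sum_(i < n) x 0 i * y 0 i.

(* The library norm [`|x|] on ['rV[R]_n] is the sup norm. *)
Definition enorm x : R := Num.sqrt (dotv x x).

Definition pderiv (i : 'I_n) f : 'rV[R]_n -> R :=
  fun x => 'D_(delta_mx 0 i) f x.

Definition grad f x : 'rV[R]_n := \row_i pderiv i f x.

(* [A] is meant to be open. *)
Definition C1_on (A : set 'rV[R]_n) f :=
  forall x, A x -> differentiable f x /\ {for x, continuous (grad f)}.

Fixpoint Ck (k : nat) f : Prop :=
  if k is k'.+1 then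
    (forall x, differentiable f x) /\ (forall i, Ck k' (pderiv i f))
  else continuous f.

Definition test_function f :=
  (forall k, Ck k f) /\ compact (closure [set x | f x != 0]).

End calculus.

(** * Sobolev spaces *)

Section sobolev.
Context {R : realType} {n : nat}.
Notation mu := (@lebesgue_rV R n).
Implicit Types (u : 'rV[R]_n -> R) (g : 'rV[R]_n -> 'rV[R]_n).

Definition Lp_on (A : set 'rV[R]_n) (q : \bar R) u : Prop :=
  u \_ A \in Lfun mu q.

Definition loc_integrable u :=
  forall K : set 'rV[R]_n, compact K -> mu.-integrable K (EFin \o u).

Definition weak_gradient u g :=
  [/\ loc_integrable u,
      forall i, loc_integrable (fun x => g x 0 i) &
      forall phi, test_function phi -> forall i,
        \int[mu]_x (u x * pderiv i phi x) = - \int[mu]_x (g x 0 i * phi x)].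

(* A representative of the weak gradient, which is unique up to a null set. *)
Definition wgrad u : 'rV[R]_n -> 'rV[R]_n :=
  xget (fun=> 0) [set g | weak_gradient u g].

Definition W1p (p : R) u :=
  Lp_on setT p%:E u /\
  exists2 g, weak_gradient u g &
    forall i, Lp_on setT p%:E (fun x => g x 0 i).

Definition W01p (Omega : set 'rV[R]_n) (p : R) u :=
  W1p p u /\ {ae mu, forall x, ~ Omega x -> u x = 0}.

End sobolev.

(** * Domains and Finsler-Minkowski norms *)

(* Near each boundary point, [Omega] lies, after an orthogonal change of
   coordinates [x |-> x *m Q], on one side of the graph of a [C^1] function
   [gamma] giving the [i]-th coordinate in terms of the other ones, [col' i]. *)
Definition C1_boundary {R : realType} {n : nat} (Omega : set 'rV[R]_n) :=
  forall x0, (closure Omega `\` interior Omega) x0 ->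
  exists (Q : 'M[R]_n) (i : 'I_n) (gamma : 'rV[R]_n.-1 -> R),
    [/\ Q *m Q^T = 1%:M, C1_on setT gamma &
        \forall x \near x0,
          Omega x <-> gamma (col' i (x *m Q)) < (x *m Q) 0 i].

Definition bounded_C1_domain {R : realType} {n : nat} (Omega : set 'rV[R]_n) :=
  [/\ Omega !=set0, open Omega, connected Omega, bounded_set Omega &
      C1_boundary Omega].

Definition finsler_minkowski {R : realType} {n : nat} (H : 'rV[R]_n -> R) :=
  [/\ forall x, 0 <= H x,
      C1_on [set x | x != 0] H,
      forall x, H x = 0 <-> x = 0 &
      forall t x, H (t *: x) = `|t| * H x] /\
  [/\ exists C1 C2, [/\ 0 < C1, 0 < C2 &
        forall x, C1 * enorm x <= H x <= C2 * enorm x] &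
      forall x y, free [:: x; y] -> H (x + y) < H x + H y].

(** * The mixed local-nonlocal problem *)

Section problem.
Context {R : realType} {n : nat}.
Notation mu := (@lebesgue_rV R n).
Variables (Omega : set 'rV[R]_n) (p s : R) (H : 'rV[R]_n -> R).
Variables (g1 g2 : 'rV[R]_n -> R).
Implicit Types (u v phi : 'rV[R]_n -> R).

Definition finsler_field (xi : 'rV[R]_n) : 'rV[R]_n :=
  if xi == 0 then 0 else H xi `^ (p - 1) *: grad H xi.

(* The kernel [|x - y|^(- n - p s)]; it takes the value [0] on the diagonal,
   which is a null set. *)
Definition frac_kernel (z : 'rV[R]_n * 'rV[R]_n) : R :=
  enorm (z.1 - z.2) `^ (- (n%:R + p * s)).

Definition signed_pow (t : R) : R := `|t| `^ (p - 2) * t.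

Definition energy u : \bar R :=
  (\int[mu]_(x in Omega) (H (wgrad u x) `^ p)%:E
   + \int[mu \x mu]_z (`|u z.1 - u z.2| `^ p * frac_kernel z)%:E
   - \int[mu]_(x in Omega) (g1 x * u x `^ p)%:E)%E.

Definition weak_supersolution v :=
  W01p Omega p v /\
  forall phi, W01p Omega p phi -> {ae mu, forall x, 0 <= phi x} ->
    (\int[mu]_(x in Omega) (g2 x * phi x)%:E <=
     \int[mu]_(x in Omega) (dotv (finsler_field (wgrad v x)) (wgrad phi x))%:E
     + \int[mu \x mu]_z (signed_pow (v z.1 - v z.2) * (phi z.1 - phi z.2)
                         * frac_kernel z)%:E
     - \int[mu]_(x in Omega) (g1 x * signed_pow (v x) * phi x)%:E)%E.

Definition ae_positive v := {ae mu, forall x, Omega x -> 0 < v x}.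

End problem.

(* Main.v *)
Require Import Defs.
From HB Require Import structures.
From mathcomp Require Import all_boot all_order all_algebra.
From mathcomp Require Import all_classical all_reals all_analysis.
From mathcomp Require Import measurable_realfun ess_sup_inf ring lra.

(** Let [v] be a positive supersolution and [u] a bounded nonnegative function
    in the energy space. The theorem follows by testing the inequality for [v]
    with [phi = u^p / (v + e)^(p-1)], [e > 0]. The first two terms of the
    tested inequality are then controlled pointwise by the energy densities
    of [u], by Picone's inequality in its local and its discrete form:
    - [H(Dv)^(p-1) DH(Dv) . D phi <= H(Du)^p] ([finsler_picone]),
    - [|v(x)-v(y)|^(p-2) (v(x)-v(y)) (phi(x)-phi(y)) <= |u(x)-u(y)|^p]
      ([discrete_picone]).
    As [g2 phi >= 0], the integral of [g1 v^(p-1) phi] is at most the sum of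
    the local and the nonlocal energy of [u] ([reaction_term_le]). When [e]
    tends to [0], [v^(p-1) phi] tends to [u^p] and is bounded by it, so that
    the energy of [u] is nonnegative ([energy_ge0]).

    Both forms of Picone's inequality come from the tangent line inequality
    for [x^p] ([powR_tangent]). The local one uses of [H] only that its
    derivative at [xi] in the direction [eta] is at most [H eta], by
    subadditivity, and is at least [H xi] for [eta = xi], by homogeneity.

    The main part of the work is the admissibility of [phi]: its weak gradient
    has to be given by the chain rule and the product rule
    ([weak_partial_comp_mul]). This is done with difference quotients. If [g]
    is the weak derivative of [u] in the direction [e_i], then for almost
    every [x] the increment [u(x + t e_i) - u(x)] is [t] times the mean of [g]
    on the segment ([weak_partial_increment]); this is tested against smooth
    functions, and the fundamental lemma of the calculus of variations
    ([loc_integrable_ae0]) concludes. Consequently the mean of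
    [|u(x + t e_i) - u(x)|] on a ball is of order [t], and along a summable
    sequence of steps the translates of [u] converge to [u] almost everywhere
    ([translates_cvg]). The increment of [f(u) h(v)] is a combination of the
    increments of [u] and [v] whose coefficients are divided differences of
    [f] and [h]. The coefficients converge almost everywhere and are bounded;
    the increments, written as means on segments, are moved by a translation
    to a fixed [g], and dominated convergence applies
    ([difference_quotient_cvg]). *)

Set Implicit Arguments.
Unset Strict Implicit.

Import Order.TTheory GRing.Theory Num.Theory.
Import numFieldNormedType.Exports.

Local Open Scope classical_set_scope.
Local Open Scope ring_scope.

(** * Borel sets and translation invariance of Lebesgue measure *)

Section borel_rV.
Context {R : realType} {n : nat}.
Implicit Types (A : set 'rV[R]_n) (x y c : 'rV[R]_n).

Definition box (a b : 'rV[R]_n) : set 'rV[R]_n :=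
  [set x | forall i, a 0 i < x 0 i < b 0 i].

Lemma normr_coord_le x i : `|x 0 i| <= `|x|.
Proof. by rewrite [`|x|]mx_normrE; apply/bigmax_geP; right; exists (0, i). Qed.

Lemma normr_rV_lt x r : 0 < r -> (forall i, `|x 0 i| < r) -> `|x| < r.
Proof.
move=> r0 h; rewrite [`|x|]mx_normrE; apply/bigmax_ltP; split => //= -[i j] _ /=.
by rewrite ord1.
Qed.

Lemma measurable_box a b : measurable (box a b).
Proof.
rewrite (_ : box a b = \bigcap_(i in [set: 'I_n])
    ((fun x : 'rV[R]_n => x 0 i) @^-1` `]a 0 i, b 0 i[)).
  apply: fin_bigcap_measurable => // i _.
  by rewrite -[X in measurable X]setTI; exact: measurable_coord.
apply/seteqP; split=> x /= h i; first by move=> _; rewrite /= in_itv/=.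
by have := h i I; rewrite /= in_itv/=.
Qed.

(** An open set is the union of the boxes with rational data that it contains. *)
Lemma open_measurable_rV A : open A -> measurable A.
Proof.
move=> oA.
(* [B (q, k)] is the cube of center [q] and half-side [1 / (k + 1)]. *)
pose B (qk : 'rV[rat]_n * nat) := box
  (\row_i (ratr (qk.1 0 i) - qk.2.+1%:R^-1)) (\row_i (ratr (qk.1 0 i) + qk.2.+1%:R^-1)).
have -> : A = \bigcup_qk (if `[< B qk `<=` A >] then B qk else set0).
  apply/seteqP; split=> [x Ax|x [qk _]]; last by case: asboolP => // h /h.
  move: (Ax); rewrite openE in oA; move=> /oA /nbhs_ballP[e /= e0 eA].
  have [k ke] : exists k : nat, k.+1%:R^-1 < e / 2.
    by exists (Num.truncn (e/2)^-1); rewrite invf_plt ?posrE ?divr_gt0// truncnS_gt.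
  set d := k.+1%:R^-1 in ke.
  have d0 : 0 < d by rewrite invr_gt0.
  have /choice[q hq] : forall i : 'I_n, exists q : rat, ratr q \in `]x 0 i - d, x 0 i + d[.
    by move=> i; apply: rat_in_itvoo; rewrite ltrD2l gt0_cp.
  exists (\row_i q i, k) => //.
  have sub : B (\row_i q i, k) `<=` A.
    move=> y By; apply: eA; rewrite -ball_normE /=.
    apply: normr_rV_lt => // i; rewrite !mxE.
    have := By i; have := hq i; rewrite in_itv/= !mxE -/d.
    rewrite ltr_norml; lra.
  rewrite asboolT// => i; rewrite !mxE -/d; have := hq i; rewrite in_itv/=; lra.
apply: countable_bigcupT_measurable; first exact: countableP.
by move=> qk; case: ifP => // _; exact: measurable_box.
Qed.

Lemma closed_measurable_rV A : closed A -> measurable A.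
Proof.
by move=> cA; rewrite -[A]setCK; apply: measurableC; apply: open_measurable_rV; exact: closed_openC.
Qed.

Lemma compact_measurable_rV A : compact A -> measurable A.
Proof. by move=> /compact_closed cA; apply: closed_measurable_rV; exact: cA. Qed.

Lemma continuous_measurable_rV (f : 'rV[R]_n -> R) :
  continuous f -> measurable_fun setT f.
Proof.
move=> cf; apply: (measurability _ (RGenOInfty.measurableE R)).
move=> _ [_ [a ->] <-]; rewrite setTI; apply: open_measurable_rV.
by apply: open_comp => // x _; exact: cf.
Qed.

(** The half-space [x_i > a] is an increasing union of boxes. With
    [setI_closed_box], a measure that is finite on boxes is thus determined by
    its values on them. *)
Lemma measurable_rVE :
  measurable = <<s [set box ab.1 ab.2 | ab in [set: 'rV[R]_n * 'rV[R]_n]] >>.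
Proof.
apply/seteqP; split; last first.
  apply: smallest_sub; first exact: sigma_algebra_measurable.
  by move=> _ [ab _ <-]; exact: measurable_box.
apply: smallest_sub; first exact: smallest_sigma_algebra.
set S := <<s _ >>.
have sS : sigma_algebra setT S by exact: smallest_sigma_algebra.
rewrite -bigcup_seq; apply: bigcup_sub => i _ _ [B mB <-]; rewrite setTI.
suff : measurable `<=` [set B : set R | S ((fun x : 'rV[R]_n => x 0 i) @^-1` B)].
  exact.
have -> : (measurable : set (set R)) = <<s @RGenOInfty.G R >> := RGenOInfty.measurableE R.
apply: smallest_sub.
  have [S0 SC SU] := sS; split => /=.
  - by rewrite preimage_set0.
  - move=> C SC'; rewrite setTD preimage_setC; rewrite -setTD; exact: SC.
  - by move=> F SF; rewrite preimage_bigcup; exact: SU.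
move=> _ [a ->] /=.
rewrite (_ : _ @^-1` _ = \bigcup_k box
   (\row_j (if j == i then a else - k%:R)) (const_mx k%:R)).
  have [_ _ SU] := sS; apply: SU => k; apply: sub_sigma_algebra.
  by exists (\row_j (if j == i then a else - k%:R), const_mx k%:R).
apply/seteqP; split => x /=.
  rewrite in_itv/= andbT => ax; exists (Num.truncn `|x|).+1 => // j.
  have : `|x 0 j| < (Num.truncn `|x|).+1%:R.
    by apply: (le_lt_trans (normr_coord_le _ _)); rewrite truncnS_gt.
  by rewrite !mxE ltr_norml; case: eqP => [->|_] /andP[? ?]; apply/andP.
by move=> [k _ /(_ i)]; rewrite !mxE eqxx in_itv/= andbT => /andP[].
Qed.

Lemma setI_closed_box :
  setI_closed [set box ab.1 ab.2 | ab in [set: 'rV[R]_n * 'rV[R]_n]].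
Proof.
move=> _ _ [[a b] _ <-] [[a' b'] _ <-] /=.
exists (\row_i Num.max (a 0 i) (a' 0 i), \row_i Num.min (b 0 i) (b' 0 i)) => //.
apply/seteqP; split=> x /=.
  move=> h; split=> i; have := h i; rewrite !mxE gt_max lt_min;
  by move=> /andP[/andP[? ?] /andP[? ?]]; apply/andP.
move=> [h h'] i; rewrite !mxE gt_max lt_min.
by have /andP[-> ->] := h i; have /andP[-> ->] := h' i.
Qed.

Lemma lebesgue_box a b :
  lebesgue_rV n (box a b) = (\prod_(i < n) lebesgue_measure `](a 0%R i), (b 0%R i)[%classic)%E.
Proof.
rewrite -lebesgue_rV_box//; congr (lebesgue_rV n _).
Qed.

Lemma lebesgue_box_fin a b : (lebesgue_rV n (box a b) < +oo)%E.
Proof.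
rewrite lebesgue_box -ge0_fin_numE; last by apply: prode_ge0.
apply: prode_fin_num => i _.
by rewrite lebesgue_measure_itv/=; case: ifP.
Qed.

Lemma bigcup_box : \bigcup_k box (const_mx (- k%:R)) (const_mx k%:R) = [set: 'rV[R]_n].
Proof.
apply/seteqP; split=> // x _; exists (Num.truncn `|x|).+1 => // j.
rewrite !mxE -ltr_norml.
by apply: (le_lt_trans (normr_coord_le _ _)); rewrite truncnS_gt.
Qed.

Lemma bounded_box A : bounded_set A -> exists k : nat, A `<=` box (const_mx (- k%:R))
  (const_mx k%:R).
Proof.
move=> [M [_ hM]]; exists (Num.truncn (`|M|+1)).+1 => x Ax i; rewrite !mxE -ltr_norml.
apply: (le_lt_trans (normr_coord_le _ _)).
apply: (le_lt_trans _ (truncnS_gt _)).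
by apply: hM => //; rewrite (le_lt_trans (ler_norm _))// ltrDl.
Qed.

Lemma lebesgue_compact_fin A : compact A -> (lebesgue_rV n A < +oo)%E.
Proof.
move=> cA; have [k sub] := bounded_box (compact_bounded cA).
apply: le_lt_trans (lebesgue_box_fin (const_mx (- k%:R)) (const_mx k%:R)).
by apply: le_measure => //; rewrite inE; [exact: compact_measurable_rV|exact: measurable_box].
Qed.

Definition cball (M : R) : set 'rV[R]_n := [set x | `|x| <= M].

Lemma compact_cball (M : R) : compact (cball M).
Proof.
apply: bounded_closed_compact.
  by exists M; split; [exact: num_real|move=> x Mx y /le_trans; apply; exact: ltW].
apply: (closed_comp (f := fun x : 'rV[R]_n => `|x|) (D := [set y | y <= M])) => [x _|];
  [exact: norm_continuous|exact: closed_le].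
Qed.

Lemma measurable_cball (M : R) : measurable (cball M).
Proof. by apply: compact_measurable_rV; exact: compact_cball. Qed.

Lemma bigcup_cball : \bigcup_k cball k%:R = [set: 'rV[R]_n].
Proof.
apply/seteqP; split=> // x _; exists (Num.truncn `|x|).+1 => //.
by rewrite /cball/= ltW// truncnS_gt.
Qed.

Lemma box_cball a b : box a b `<=` cball (`|a| + `|b|).
Proof.
move=> x bx; rewrite /cball/= [leLHS]mx_normrE; apply/bigmax_leP; split; first by rewrite addr_ge0.
move=> -[i0 i] _ /=; rewrite ord1; have /andP[ai bi] := bx i.
have := normr_coord_le a i; have := normr_coord_le b i.
rewrite !ler_norml; have := normr_ge0 a; have := normr_ge0 b; lra.
Qed.

Lemma measurable_shift c : measurable_fun setT (fun x : 'rV[R]_n => x + c).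
Proof.
apply: measurable_fun_rVP => i; under eq_fun do rewrite mxE.
by apply: measurable_funD => //; exact: measurable_coord.
Qed.

Let shift_measure c : {measure set 'rV[R]_n -> \bar R}.
Proof.
unshelve refine (pushforward (lebesgue_rV n) (fun x : 'rV[R]_n => x + c)).
exact: measurable_shift.
Defined.

(** Uniqueness of measures: both sides agree on boxes. *)
Lemma lebesgue_rV_shift c A : measurable A ->
  lebesgue_rV n ((fun x => x + c) @^-1` A) = lebesgue_rV n A.
Proof.
apply: (measure_unique _ (fun k => box (const_mx (- k%:R)) (const_mx k%:R))
  measurable_rVE setI_closed_box _ bigcup_box (shift_measure c)).
- by move=> k; exists (const_mx (- k%:R), const_mx k%:R).
- move=> _ [[a b] _ <-] /=; rewrite /pushforward.
  rewrite (_ : _ @^-1` _ = box (a - c) (b - c)).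
    rewrite !lebesgue_box; apply: eq_bigr => i _.
    rewrite !lebesgue_measure_itv/= !lte_fin !mxE ltrD2r; case: ifP => // _.
    by rewrite -!EFinB; congr EFin; ring.
  apply/seteqP; split=> x /= h i; have := h i; rewrite !mxE; lra.
- move=> k /=; rewrite /pushforward.
  rewrite (_ : _ @^-1` _ = box (const_mx (- k%:R) - c) (const_mx k%:R - c)).
    exact: lebesgue_box_fin.
  apply/seteqP; split=> x /= h i; have := h i; rewrite !mxE; lra.
Qed.

Lemma ge0_integral_shift c (f : 'rV[R]_n -> \bar R) : measurable_fun setT f ->
  (forall x, 0 <= f x)%E ->
  (\int[lebesgue_rV n]_x f (x + c)%R = \int[lebesgue_rV n]_x f x)%E.
Proof.
move=> mf f0.
have := ge0_integral_pushforward (measurable_shift c) (lebesgue_rV n) (@measurableT _ _) mf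
  (fun x _ => f0 x).
rewrite preimage_setT => <-.
apply: (eq_measure_integral (lebesgue_rV n) (m1 := shift_measure c)) => A mA _;
  exact/lebesgue_rV_shift.
Qed.

Lemma integrable_shift c (f : 'rV[R]_n -> R) :
  (lebesgue_rV n).-integrable setT (EFin \o f) ->
  (lebesgue_rV n).-integrable setT (EFin \o (fun x => f (x + c))).
Proof.
move=> /integrableP[mf If]; apply/integrableP; split.
  exact: measurableT_comp mf (measurable_shift c).
rewrite (@ge0_integral_shift c (fun x => `|(f x)%:E|%E))//.
exact: measurableT_comp.
Qed.

Lemma Rintegral_shift c (f : 'rV[R]_n -> R) : measurable_fun setT f ->
  \int[lebesgue_rV n]_x f (x + c) = \int[lebesgue_rV n]_x f x.
Proof.
move=> mf; rewrite /Rintegral; congr fine; rewrite integralE [RHS]integralE.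
have /measurable_EFinP mf' := mf.
congr (_ - _)%E.
  apply: etrans (ge0_integral_shift c (measurable_funepos mf') _) => //.
  by apply: eq_integral => x _; rewrite !funeposE.
apply: etrans (ge0_integral_shift c (measurable_funeneg mf') _) => //.
by apply: eq_integral => x _; rewrite !funenegE.
Qed.

End borel_rV.

(** * Smooth test functions *)

Section flat.
Context {R : realType}.
Implicit Types (P : {poly R}) (x y : R).

(** The functions [P(1/x) exp(-1/x)], extended by [0] to the half-line
    [x <= 0]. This family is stable under differentiation, so that all its
    members are smooth. *)
Definition flat P x : R := if 0 < x then P.[x^-1] * expR (- x^-1) else 0.

Lemma expRN_powM k y : 0 <= y -> y ^+ k.+1 * expR (- y) <= (k.+1)`!%:R.
Proof.
move=> y0; rewrite expRN ler_pdivrMr ?expR_gt0//.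
have := expR_ge1Dxn k y0.
have f0 : 0 < (k.+1)`!%:R :> R by rewrite ltr0n fact_gt0.
rewrite -ler_pdivrMl// mulrC.
by apply: le_trans; rewrite lerDr.
Qed.

(** The exponential dominates all powers; the exponent [2] is what
    differentiability at [0] takes. *)
Lemma flat_bound P : exists2 C, 0 <= C & forall x, 0 < x < 1 -> `|flat P x| <= C * x ^+ 2.
Proof.
exists ((\sum_(i < size P) `|P`_i|) * ((size P).+2)`!%:R).
  by rewrite mulr_ge0// sumr_ge0.
move=> x /andP[x0 x1]; rewrite /flat x0 -ler_pdivrMr ?exprn_gt0// -exprVn.
set y := x^-1; have y1 : 1 <= y by rewrite invf_ge1// ltW.
have y0 : 0 <= y by exact: le_trans y1.
rewrite normrM (ger0_norm (expR_ge0 _)).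
have hP : `|P.[y]| <= (\sum_(i < size P) `|P`_i|) * y ^+ (size P).
  rewrite horner_coef (le_trans (ler_norm_sum _ _ _))// mulr_suml ler_sum// => i _.
  rewrite normrM normrX (ger0_norm y0) ler_wpM2l//.
  by rewrite ler_weXn2l// ltnW.
apply: (@le_trans _ _ ((\sum_(i < size P) `|P`_i|) * (y ^+ (size P).+2 * expR (- y)))).
  rewrite mulrAC [leRHS]mulrA ler_wpM2r ?expR_ge0//.
  by rewrite -(addn2 (size P)) exprD [leRHS]mulrA ler_wpM2r// exprn_ge0.
by rewrite ler_wpM2l ?sumr_ge0// expRN_powM.
Qed.

Lemma is_derive_flat P x : is_derive x 1 (flat P) (flat ((P - P^`()) * 'X^2) x).
Proof.
case: (ltrgtP 0 x) => [x0|x0|<-].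
- have e : \forall y \near x, ((fun z => P.[z] * expR (- z)) \o (fun z => z^-1)) y = flat P y.
    near=> y; rewrite /flat ifT//; near: y; exact: lt_nbhsr.
  apply: (near_eq_is_derive e).
  have dV : is_derive x 1 (fun z : R => z^-1) (- x ^- 2).
    have := @is_deriveV R id x 1 1; rewrite /GRing.scale/= mulr1; apply.
    by rewrite gt_eqF.
  have dE : is_derive x^-1 1 (fun z : R => expR (- z)) (- expR (- x^-1)).
    by rewrite -mulrN1; apply: is_derive1_comp.
  apply: is_derive_eq.
  rewrite /flat x0 !hornerE /GRing.scale/= -exprVn; ring.
- have e : \forall y \near x, (cst 0 : R -> R) y = flat P y.
    near=> y; rewrite /flat ifF//; apply/negbTE; rewrite -leNgt ltW//; near: y; exact: lt_nbhsl.
  rewrite /flat ltNge (ltW x0)/=.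
  exact: (near_eq_is_derive e).
- have [C C0 hC] := flat_bound P.
  rewrite {2}/flat ltxx.
  have cv : h^-1 *: ((flat P \o shift 0) (h *: 1) - flat P 0) @[h --> 0^'] --> (0 : R).
    apply/cvgrPdist_le => /= e e0.
    have C1 : 0 < C + 1 by rewrite ltr_wpDl.
    have Ce : 0 < Num.min 1 (e / (C + 1)) by rewrite lt_min ltr01 divr_gt0.
    exists (Num.min 1 (e / (C + 1))) => //= h.
    rewrite /ball_/= sub0r normrN lt_min => /andP[h1 hC1 h0].
    rewrite {2}/flat ltxx subr0 /= addr0 sub0r normrN.
    have [hp|hp] := ltrP 0 h; last by rewrite /flat /GRing.scale/= mulr1 ltNge hp/= mulr0 normr0
      ltW.
    rewrite gtr0_norm // in h1; rewrite gtr0_norm// in hC1.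
    have /hC : 0 < h < 1 by rewrite hp.
    rewrite [h%:A]mulr1 [h^-1 *: _]mulrC normrM (gtr0_norm
      (x:=h^-1)) ?invr_gt0// ler_pdivrMr// => /le_trans; apply.
    rewrite expr2 mulrA ler_wpM2r ?(ltW hp)//.
    move: hC1; rewrite ltr_pdivlMr// => hC1; apply: ltW; apply: le_lt_trans hC1.
    by rewrite mulrC ler_wpM2l ?ltW// ltrDl.
  apply: DeriveDef; last exact/cvg_lim.
  by apply/cvg_ex; exists 0.
Unshelve. all: by end_near. Qed.

Lemma flat_gt0 x : 0 < x -> flat 1 x = expR (- x^-1).
Proof. by move=> x0; rewrite /flat x0 hornerC mul1r. Qed.

Lemma flat_le0 P x : x <= 0 -> flat P x = 0.
Proof. by move=> x0; rewrite /flat ltNge x0. Qed.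

Lemma flat_ge0 x : 0 <= flat 1 x.
Proof. by have [x0|x0] := ltrP 0 x; [rewrite flat_gt0// expR_ge0|rewrite flat_le0]. Qed.

Lemma flat_le1 x : flat 1 x <= 1.
Proof.
have [x0|x0] := ltrP 0 x; last by rewrite flat_le0// ler01.
by rewrite flat_gt0// -expR0 ler_expR oppr_le0 invr_ge0 ltW.
Qed.

Lemma flat_cvg1 x : 0 < x -> flat 1 (k.+1%:R * x) @[k --> \oo] --> (1 : R).
Proof.
move=> x0.
have -> : (fun k : nat => flat 1 (k.+1%:R * x)) = (fun k => expR (- (harmonic k * x^-1))).
  by apply/funext => k; rewrite flat_gt0 ?mulr_gt0// invfM.
rewrite -expR0 -oppr0 -(mul0r x^-1).
apply: (@cvg_comp _ _ _ (fun k : nat =>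
  - (harmonic k * x^-1)) expR \oo (nbhs (- (0 / x))) _ _ (@continuous_expR R _)).
by apply: cvgN; apply: cvgMl; exact: cvg_harmonic.
Qed.

End flat.

Section Ck_theory.
Context {R : realType} {n : nat}.
Implicit Types (f g : 'rV[R]_n -> R).

Lemma CkW k f : Ck k.+1 f -> Ck k f.
Proof.
elim: k f => [|k IH] f /= [df pf]; first by move=> x; exact: differentiable_continuous.
by split => // i; exact/IH/pf.
Qed.

Lemma Ck_cst k (c : R) : Ck k (fun _ : 'rV[R]_n => c).
Proof.
elim: k c => [|k IH] c /=; first by move=> x; exact: cst_continuous.
split=> // i; rewrite (_ : pderiv _ _ = fun=> 0)//.
by apply/funext => x; rewrite /pderiv derive_cst.
Qed.

Lemma CkD k f g : Ck k f -> Ck k g -> Ck k (fun x => f x + g x).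
Proof.
elim: k f g => [|k IH] f g /=; first by move=> cf cg x; exact: (continuousD (cf x) (cg x)).
move=> [df pf] [dg pg]; split => [x|i]; first exact: differentiableD.
rewrite (_ : pderiv _ _ = fun x => pderiv i f x + pderiv i g x); first exact: IH.
by apply/funext => x; rewrite /pderiv deriveD//; exact: diff_derivable.
Qed.

Lemma CkM k f g : Ck k f -> Ck k g -> Ck k (fun x => f x * g x).
Proof.
elim: k f g => [|k IH] f g; first by move=> cf cg x; exact: (continuousM (cf x) (cg x)).
move=> Cf Cg; have [df pf] : (forall x, differentiable f x) /\ (forall i, Ck k (pderiv i f)) := Cf.
have [dg pg] : (forall x, differentiable g x) /\ (forall i, Ck k (pderiv i g)) := Cg.
split => [x|i]; first exact: differentiableM.
rewrite (_ : pderiv _ _ = fun x => f x * pderiv i g x + g x * pderiv i f x).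
  by apply: CkD; apply: IH => //; exact: CkW.
by apply/funext => x; rewrite /pderiv deriveM//; exact: diff_derivable.
Qed.

Lemma Ck_prod (I : finType) k (f : I -> 'rV[R]_n -> R) :
  (forall i, Ck k (f i)) -> Ck k (fun x => \prod_i f i x).
Proof.
move=> Cf; rewrite (_ : (fun _ => _) = \big[(fun f g x => f x * g x)/(fun=> 1)]_i f i).
  by elim/big_ind : _ => //; [exact: Ck_cst|move=> *; exact: CkM].
by apply/funext => x; elim/big_rec2 : _ => // i y1 y2 _ ->.
Qed.

Lemma is_derive_affine (F : R -> R) (F' a b : R) i (x v : 'rV[R]_n) :
  is_derive (a * x 0 i + b) 1 F F' ->
  is_derive x v (fun z : 'rV[R]_n => F (a * z 0 i + b)) (a * v 0 i * F').
Proof.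
move=> dF.
have diffF : differentiable F (a * x 0 i + b) by apply/derivable1_diffP.
have {}dF : is_derive (a * x 0 i + b) (a * v 0 i) F (a * v 0 i * F').
  apply: DeriveDef; first exact: diff_derivable.
  by rewrite deriveE// diff1E// derive1E (derive_val (is_derive := dF)).
have e : (fun h : R => h^-1 *: (((fun z : 'rV[R]_n => F (a * z 0 i + b)) \o shift x) (h *: v)
   - F (a * x 0 i + b))) = (fun h => h^-1 *: ((F \o shift (a * x 0 i + b)) (h *: (a * v 0 i))
   - F (a * x 0 i + b))).
  apply/funext => h /=; congr (_ *: (F _ - _)); rewrite !mxE /GRing.scale/=; ring.
have [dv vd] := dF.
by apply: DeriveDef; [rewrite /derivable e|rewrite -vd /derive e].
Qed.

(** All the functions of a sequence of successive derivatives are treated at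
    once, since a partial derivative of one is a multiple of the next. *)
Lemma Ck_affine (F : nat -> R -> R) :
  (forall m (x : R), is_derive x 1 (F m) (F m.+1 x)) ->
  forall k m a b i, Ck k (fun x : 'rV[R]_n => F m (a * x 0 i + b)).
Proof.
move=> dF k.
have diffF m a b i (x : 'rV[R]_n) : differentiable (fun x : 'rV[R]_n => F m (a * x 0 i + b)) x.
  apply: (@differentiable_comp _ _ _ _ (fun x : 'rV[R]_n => a * x 0 i + b) (F m)).
    apply: differentiableD => //; apply: differentiableM => //; exact: differentiable_coord.
  by apply/derivable1_diffP; have [] := dF m (a * x 0 i + b).
elim: k => [|k IH] m a b i; first by move=> x; exact/differentiable_continuous/diffF.
split => // j.
rewrite (_ : pderiv _ _ = fun x : 'rV[R]_n => a * (j == i)%:R * F m.+1 (a * x 0 i + b)).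
  by apply: CkM; [exact: Ck_cst|exact: IH].
apply/funext => x; rewrite /pderiv.
have := @is_derive_affine (F m) _ a b i x (delta_mx 0 j) (dF m (a * x 0 i + b)).
by move=> /@derive_val ->; rewrite mxE eqxx/= eq_sym.
Qed.

Lemma test_functionP f M : (forall k, Ck k f) -> (forall x, f x != 0 -> `|x| <= M) ->
  test_function f.
Proof.
move=> Cf fM; split => //.
have cB : closed (cball M : set 'rV[R]_n) by apply: compact_closed => //; exact: compact_cball.
have sub : closure [set x | f x != 0] `<=` cball M.
  by rewrite [X in _ `<=` X](closure_id _).1//; apply: closure_subset => x /fM.
apply: bounded_closed_compact; last exact: closed_closure.
have [K [Kr hK]] := @compact_bounded _ _ _ (@compact_cball R n M).
by exists K; split => // x Kx y /sub; exact: hK.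
Qed.

Lemma test_function_bounded f : test_function f -> exists M, forall x, f x != 0 -> `|x| <= M.
Proof.
move=> [_ /compact_bounded[M [_ h]]]; exists (M + 1) => x fx0.
by apply: h; [rewrite ltrDl|exact: subset_closure].
Qed.

(** Smooth functions with values in [0, 1], supported in a box, which tend to
    its indicator. *)
Definition bump (a b : 'rV[R]_n) (k : nat) (x : 'rV[R]_n) : R :=
  \prod_i (flat 1 (k.+1%:R * x 0 i + (- (k.+1%:R * a 0 i))) * flat 1 (- k.+1%:R *
    x 0 i + k.+1%:R * b 0 i)).

Lemma bump_itv a b k x : 0 <= bump a b k x <= 1.
Proof.
apply/andP; split.
  by apply: prodr_ge0 => i _; rewrite mulr_ge0// flat_ge0.
by apply: prodr_ile1 => i _; rewrite mulr_ge0 ?flat_ge0//= mulr_ile1 ?flat_ge0 ?flat_le1.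
Qed.

Lemma bump_out a b k x : ~ box a b x -> bump a b k x = 0.
Proof.
move=> /existsNP[i] /negP; rewrite negb_and -!leNgt => ab.
rewrite /bump (bigD1 i)//=; apply/eqP; rewrite mulf_eq0; apply/orP; left.
have k0 : 0 <= k.+1%:R :> R by [].
rewrite mulf_eq0; case/orP : ab => h; apply/orP; [left|right]; rewrite flat_le0//.
  by rewrite -mulrBr mulr_ge0_le0// subr_le0.
by rewrite mulNr addrC -mulrBr mulr_ge0_le0// subr_le0.
Qed.

Lemma bump_cvg a b x : box a b x -> bump a b k x @[k --> \oo] --> (1 : R).
Proof.
move=> bx.
rewrite (_ : 1 = \prod_(i < n) (1 * 1 : R)); last by rewrite big1// => i _; rewrite mulr1.
rewrite /bump; apply: cvg_big => //; first exact: mul_continuous.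
move=> i _; have /andP[ai bi] := bx i; apply: cvgM.
  under eq_fun do rewrite -mulrBr.
  by apply: flat_cvg1; rewrite subr_gt0.
under eq_fun do rewrite mulNr addrC -mulrBr.
by apply: flat_cvg1; rewrite subr_gt0.
Qed.

Lemma test_function_bump a b k : test_function (bump a b k).
Proof.
apply: (@test_functionP _ (`|a| + `|b|)).
  move=> m; pose P k : {poly R} := iter k (fun P => (P - P^`()) * 'X^2) 1.
  by apply: Ck_prod => i; apply: CkM;
    apply: (@Ck_affine (fun k => flat (P k)) _ _ 0%N) => j x; exact: is_derive_flat.
move=> x; apply: contraNT => /negP abx; apply/eqP/bump_out => bx.
exact/abx/box_cball.
Qed.

End Ck_theory.

(** * Locally integrable functions *)

Section locint.
Context {R : realType} {n : nat}.
Notation mu := (@lebesgue_rV R n).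
Implicit Types (f g : 'rV[R]_n -> R) (C M : R).

Lemma loc_integrable_measurable f : loc_integrable f -> measurable_fun setT f.
Proof.
move=> lf; rewrite -bigcup_cball; apply/measurable_fun_bigcup => [k|k];
  first exact: measurable_cball.
by apply/measurable_EFinP; apply: (@measurable_int _ _ _ mu); exact/lf/compact_cball.
Qed.

Lemma loc_integrableM f g C M : loc_integrable f -> measurable_fun setT g ->
  (forall x, `|g x| <= C) -> (forall x, g x != 0 -> `|x| <= M) ->
  mu.-integrable setT (EFin \o (fun x => f x * g x)).
Proof.
move=> lf mg gC gM.
have mf := loc_integrable_measurable lf.
have C0 : 0 <= C by exact: le_trans (gC 0).
have If : mu.-integrable setT (fun x => (C%:E * ((EFin \o f) \_ (cball M)) x)%E).
  apply: integrableZl => //.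
  by apply: (integrable_mkcond _ (measurable_cball M)).1; exact/lf/compact_cball.
apply: le_integrable If => //.
  by apply/measurable_EFinP; exact: measurable_funM.
move=> x _ /=; rewrite patchE abseM; case: ifPn => [xM|].
  by rewrite /= -EFinM lee_fin normrM mulrC (ger0_norm C0) ler_wpM2r.
rewrite notin_setE /cball/= => /negP; rewrite -ltNge => Mx.
have -> : g x = 0 by apply/eqP; apply: contraTT Mx => /gM; rewrite -leNgt.
by rewrite mulr0 normr0 mule_ge0.
Qed.

Lemma loc_integrable_bounded f C : measurable_fun setT f -> (forall x, `|f x| <= C) ->
  loc_integrable f.
Proof.
move=> mf fC K cK; apply: (@le_integrable _ _ _ mu K _ _ (cst C%:E)).
- exact: compact_measurable_rV.
- by apply: measurable_funTS; exact/measurable_EFinP.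
- by move=> x _ /=; rewrite lee_fin (le_trans (fC x))// ler_norm.
- apply/integrableP; split => //.
  rewrite (eq_integral (cst `|C|%:E))//= integral_cst//; last exact: compact_measurable_rV.
  by rewrite lte_mul_pinfty//; exact: lebesgue_compact_fin.
Qed.

Lemma loc_integrableM_bounded f g C : loc_integrable f -> measurable_fun setT g ->
  (forall x, `|g x| <= C) -> loc_integrable (fun x => g x * f x).
Proof.
move=> lf mg gC K cK.
have mK := compact_measurable_rV cK.
have := lf K cK => /(integrableZl mK C) h.
apply: le_integrable h => //.
  apply: measurable_funTS; apply/measurable_EFinP; apply: measurable_funM => //.
  exact: loc_integrable_measurable.
move=> x _ /=; by rewrite lee_fin !normrM ler_wpM2r// (le_trans (gC x))// ler_norm.
Qed.

Lemma loc_integrableD f g : loc_integrable f -> loc_integrable g ->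
  loc_integrable (fun x => f x + g x).
Proof.
move=> lf lg K cK; have mK := compact_measurable_rV cK.
by have := integrableD mK (lf K cK) (lg K cK).
Qed.

Lemma loc_integrableB f g : loc_integrable f -> loc_integrable g ->
  loc_integrable (fun x => f x - g x).
Proof.
move=> lf lg K cK; have mK := compact_measurable_rV cK.
by have := integrableB mK (lf K cK) (lg K cK).
Qed.

Lemma test_function_continuous f : test_function f -> continuous f.
Proof. by move=> [/(_ 0%N)]. Qed.

Lemma test_function_measurable f : test_function f -> measurable_fun setT f.
Proof. by move=> /test_function_continuous; exact: continuous_measurable_rV. Qed.

Lemma bounded_continuous_supp f M : continuous f -> (forall x, f x != 0 -> `|x| <= M) ->
  exists C, forall x, `|f x| <= C.
Proof.
move=> cf fM.
have : compact (f @` cball M).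
  by apply: continuous_compact; [exact: continuous_subspaceT|exact: compact_cball].
move=> /compact_bounded[C [_ hC]]; exists (`|C| + 1) => x.
have C0 : 0 <= `|C| + 1 by rewrite addr_ge0.
have [->|/fM xM] := eqVneq (f x) 0; first by rewrite normr0.
by apply: hC; [rewrite (le_lt_trans (ler_norm _))// ltrDl|exists x].
Qed.

Lemma pderiv_test_function f i : test_function f -> test_function (pderiv i f).
Proof.
move=> tf; have [Cf cf] := tf; have [M fM] := test_function_bounded tf.
apply: (@test_functionP _ _ _ M); first by move=> k; have [_ ] := Cf k.+1; exact.
move=> x; apply: contraNT; rewrite -ltNge => Mx; apply/eqP.
rewrite /pderiv (@near_eq_derive _ _ _ f (cst 0)) ?derive_cst//.
have : \forall y \near x, M < `|y|.
  exact: (@norm_continuous _ 'rV[R]_n x _ (lt_nbhsr Mx)).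
apply: filterS => y My; apply/eqP; apply: contraTT My => /fM; by rewrite -leNgt.
Qed.

Lemma test_function_bound f : test_function f -> exists C M,
  (forall x, `|f x| <= C) /\ (forall x, f x != 0 -> `|x| <= M).
Proof.
move=> tf; have [M fM] := test_function_bounded tf.
have [C hC] := bounded_continuous_supp (test_function_continuous tf) fM.
by exists C, M.
Qed.

Lemma integrable_test f g : loc_integrable f -> test_function g ->
  mu.-integrable setT (EFin \o (fun x => f x * g x)).
Proof.
move=> lf tg; have [C [M [gC gM]]] := test_function_bound tg.
exact: (loc_integrableM lf (test_function_measurable tg) gC gM).
Qed.

Lemma integrable_box f a b : loc_integrable f -> mu.-integrable (box a b) (EFin \o f).
Proof.
move=> lf; apply: (@integrableS _ _ _ mu (cball (`|a| + `|b|))); last exact/lf/compact_cball.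
- exact: measurable_cball.
- exact: measurable_box.
- exact: box_cball.
Qed.

(** The functions [bump a b k] converge to the indicator of the box. *)
Lemma integral_box0 f a b : loc_integrable f ->
  (forall psi, test_function psi -> \int[mu]_x (f x * psi x) = 0) ->
  (\int[mu]_(x in box a b) (f x)%:E = 0)%E.
Proof.
move=> lf h.
have mf := loc_integrable_measurable lf.
rewrite integral_mkcond.
have Ik k : mu.-integrable setT (EFin \o (fun x => f x * bump a b k x)).
  exact/integrable_test/test_function_bump.
have I0 k : (\int[mu]_x (f x * bump a b k x)%:E = 0)%E.
  have := h _ (test_function_bump a b k).
  rewrite /Rintegral -[RHS]/(fine 0%E).
  by move=> e; rewrite -[LHS]fineK ?e//; apply: integrable_fin_num => //; exact: Ik.
have Ib : mu.-integrable setT (abse \o (EFin \o f) \_ (box a b)).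
  apply: integrable_abse; apply: (integrable_mkcond _ (measurable_box a b)).1.
  exact: integrable_box.
have [|||||_ _] := @dominated_convergence _ _ _ mu setT measurableT
  (fun k x => (f x * bump a b k x)%:E) ((EFin \o f) \_ (box a b)) (abse \o (EFin \o f) \_
    (box a b)).
- by move=> k; have /integrableP[] := Ik k.
- apply/measurable_restrict => //; first exact: measurable_box.
  by apply: measurable_funTS; apply/measurable_EFinP.
- apply: aeW => x _; rewrite patchE; case: ifPn => [|].
    rewrite inE => bx; apply: cvg_EFin; first by near=> k.
    rewrite -[X in _ --> X]mulr1; apply: cvgMr; exact: bump_cvg.
  rewrite notin_setE => bx; under eq_fun do rewrite bump_out// mulr0; exact: cvg_cst.
- exact: Ib.
- apply: aeW => x k _ /=; rewrite patchE; case: ifPn => [|].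
    move=> _; rewrite /= lee_fin normrM ler_piMr//.
    by have /andP[b0 b1] := bump_itv a b k x; rewrite ger0_norm.
  by rewrite notin_setE => bx; rewrite bump_out// mulr0 normr0 abse_ge0.
under eq_fun do rewrite I0.
by move=> /cvg_lim <-//; rewrite lim_cst.
Unshelve. all: by end_near. Qed.

(** The fundamental lemma of the calculus of variations: the integral of [f]
    vanishes on boxes, hence on all Borel sets by Dynkin's theorem. *)
Lemma loc_integrable_ae0 f : loc_integrable f ->
  (forall psi, test_function psi -> \int[mu]_x (f x * psi x) = 0) ->
  {ae mu, forall x, f x = 0}.
Proof.
move=> lf h.
have mf := loc_integrable_measurable lf.
pose B (k : nat) : set 'rV[R]_n := box (const_mx (- k%:R)) (const_mx k%:R).
have mB k : measurable (B k) by exact: measurable_box.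
suff ae k : {ae mu, forall x, B k x -> f x = 0}.
  have := ae_foralln ae; apply: filterS => x fx.
  have [k _ Bk] : (\bigcup_k B k) x by rewrite bigcup_box.
  exact: fx Bk.
have IB : mu.-integrable (B k) (EFin \o f).
  exact: integrable_box.
pose F : 'rV[R]_n -> \bar R := (EFin \o f) \_ (B k).
have IF : mu.-integrable setT F by apply: (integrable_mkcond _ (mB k)).1.
have IFS S : measurable S -> mu.-integrable S F by move=> mS; apply: integrableS IF.
have FT : (\int[mu]_(x in setT) F x = 0)%E by rewrite -integral_mkcond integral_box0.
suff F0 : forall S, measurable S -> (\int[mu]_(x in S) F x = 0)%E.
  have := @integral_ae_eq _ _ _ mu setT measurableT (cst 0%E) F IF.
  move=> /(_ (measurable_cst _)) [E _ mE|].
    by rewrite integral0 F0.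
  move=> N [mN N0 hN]; exists N; split => // x /= nx; apply: hN => /= /(_ I).
  rewrite /F patchE; case: ifPn => [|]; last by rewrite notin_setE => nB _; apply: nx => /nB.
  by move=> _ [fx]; apply: nx => _.
move=> S mS.
have : <<s [set box ab.1 ab.2 | ab in [set: 'rV[R]_n * 'rV[R]_n]] >> S by rewrite -measurable_rVE.
apply: (@dynkin_induction _ _ _ (fun S =>
  (\int[mu]_(x in S) F x)%E = 0%E) measurable_rVE setI_closed_box) => //.
- move=> _ [[a b] _ <-] /=; rewrite /F -integral_mkcondr.
  have [[a' b'] _ /= <-] : [set box ab.1 ab.2 | ab in [set: 'rV[R]_n * 'rV[R]_n]] (box a b `&` B k).
    by apply: setI_closed_box; [exists (a, b)|exists (const_mx (- k%:R), const_mx k%:R)].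
  exact: integral_box0.
- move=> A mA A0; have := FT.
  rewrite -(setUv A) integral_setU//; last 3 first.
  + exact: measurableC.
  + by rewrite setUv; have /integrableP[] := IF.
  + by rewrite disj_set2E setICr.
  by rewrite A0 add0e.
- move=> G mG tG G0; rewrite integral_bigcup//; last first.
    by apply: IFS; exact: bigcup_measurable.
  by apply: eseries0 => i _ _; exact: G0.
Qed.

End locint.

(** * Real-valued integrals and null sets *)

Section Rfubini.
Context d1 d2 (T1 : measurableType d1) (T2 : measurableType d2) (R : realType).
Variables (m1 : {sigma_finite_measure set T1 -> \bar R}) (m2 : {sigma_finite_measure set T2 ->
  \bar R}).
Variable f : T1 * T2 -> R.
Hypothesis If : (m1 \x m2)%E.-integrable setT (EFin \o f).

Lemma Rintegral_fubini1 :
  \int[m1]_x \int[m2]_y f (x, y) = \int[(m1 \x m2)%E]_z f z.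
Proof.
rewrite [RHS]/Rintegral -(integral12_prod_meas1 If) [LHS]/Rintegral; congr fine.
have IF := integrable_fubini_F If.
apply: ae_eq_integral => //.
- apply/measurable_EFinP; apply: measurableT_comp => //.
  by have /integrableP[] := IF.
- by have /integrableP[] := IF.
have := integrable_ae measurableT IF; apply: filterS => x /(_ I) + _.
by move=> h; rewrite /Rintegral fineK.
Qed.

Lemma integrable_fubini_G : m2.-integrable setT (fubini_G m1 (EFin \o f)).
Proof.
have mf := measurable_int _ If.
apply/integrableP; split; first exact: (measurable_fubini_G If).
apply: le_lt_trans ((integrable21ltyP m1 m2 mf).1 If).
apply: ge0_le_integral => //.
- by apply: measurableT_comp => //; exact: (measurable_fubini_G If).
- by apply: (measurable_fun_fubini_tonelli_G (m1 := m1) (abse \o (EFin \o f))) => //=;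
    exact: measurableT_comp.
- by move=> y _; apply: le_abse_integral => //; exact: measurableT_comp.
Qed.

Lemma Rintegral_fubini2 :
  \int[m2]_y \int[m1]_x f (x, y) = \int[(m1 \x m2)%E]_z f z.
Proof.
rewrite [RHS]/Rintegral -(integral21_prod_meas1 If) [LHS]/Rintegral; congr fine.
have IF := integrable_fubini_G.
apply: ae_eq_integral => //.
- apply/measurable_EFinP; apply: measurableT_comp => //.
  by have /integrableP[] := IF.
- by have /integrableP[] := IF.
have := integrable_ae measurableT IF; apply: filterS => x /(_ I) + _.
by move=> h; rewrite /Rintegral fineK.
Qed.

Lemma integrable_Rfubini2 : m2.-integrable setT (EFin \o (fun y => \int[m1]_x f (x, y))).
Proof.
have IF := integrable_fubini_G.
have [mF _] := integrableP _ _ _ IF.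
apply: le_integrable IF => //.
  by apply/measurable_EFinP; apply: measurableT_comp mF.
move=> x _ /=; rewrite /Rintegral -/(fubini_G m1 (EFin \o f) x).
by case: (fubini_G _ _ _) => //=; rewrite normr0 leey.
Qed.

End Rfubini.

Section unit_interval.
Context {R : realType}.

Local Notation lam := (uniform_prob (@ltr01 R)).

(** The uniform probability on [0, 1] stands for Lebesgue measure on this interval,
    so that it can be a factor of a product measure. *)
Lemma ge0_integral_lam (f : R -> \bar R) : measurable_fun setT f -> (forall x, 0 <= f x)%E ->
  (\int[lam]_x f x = \int[lebesgue_measure]_(x in `[0%R, 1%R]) f x)%E.
Proof.
move=> mf f0; rewrite integral_uniform//.
by rewrite subr0 invr1 mul1e.
Qed.

Lemma Rintegral_lam (f : R -> R) : measurable_fun setT f ->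
  \int[lam]_x f x = \int[lebesgue_measure]_(x in `[0%R, 1%R]) f x.
Proof.
move=> /measurable_EFinP mf; rewrite /Rintegral; congr fine.
rewrite integralE [RHS]integralE !ge0_integral_lam//.
  exact: measurable_funeneg.
exact: measurable_funepos.
Qed.

Lemma integral_lam_le (f : R -> \bar R) (C : \bar R) : measurable_fun setT f ->
  (forall x, 0 <= f x)%E -> (forall x : R, (0 <= x <= 1)%R -> f x <= C)%E ->
  (\int[lam]_x f x <= C)%E.
Proof.
move=> mf f0 fC; rewrite ge0_integral_lam//.
have C0 : (0 <= C)%E by apply: le_trans (fC 0 _) => //; rewrite lexx ler01.
apply: (@le_trans _ _ (\int[lebesgue_measure]_(x in `[0%R, 1%R]) cst C x)%E).
  by apply: ge0_le_integral => //; exact: measurable_funTS.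
rewrite integral_cst//= lebesgue_measure_itv/= lte_fin ltr01.
by rewrite oppr0 adde0 mule1.
Qed.

Lemma lam_ae01 : {ae lam, forall r, 0 <= r <= 1}.
Proof.
exists (~` `[0, 1]); split => //.
- by apply: measurableC.
- have m : measurable (~` `[0:R, 1]) by exact: measurableC.
  have := integral_indic lam measurableT m; rewrite setIT => <-.
  rewrite ge0_integral_lam//; first last.
    by apply/measurable_EFinP; exact: measurable_indic.
  by rewrite integral_indic//= setICl measure0.
Qed.

End unit_interval.

Section ae.
Context d (T : measurableType d) (R : realType) (m : {measure set T -> \bar R}).
Implicit Types (P Q : T -> Prop).

Lemma ae_imp P Q :
  (forall x, P x -> Q x) -> {ae m, forall x, P x} -> {ae m, forall x, Q x}.
Proof.
by move=> PQ [N [mN N0 NP]]; exists N; split => // x nQ; apply: NP => /= Px; exact/nQ/PQ.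
Qed.

Lemma ae_and P Q :
  {ae m, forall x, P x} -> {ae m, forall x, Q x} -> {ae m, forall x, P x /\ Q x}.
Proof.
move=> [N [mN N0 NP]] [N' [mN' N0' NP']]; exists (N `|` N'); split.
- exact: measurableU.
- by rewrite measureU0.
- move=> x /= nPQ; have [Px|nP] := pselect (P x); last by left; exact: NP.
  by right; apply: NP' => /= Qx; exact: nPQ.
Qed.

End ae.

Section ae_prod.
Context d1 d2 (T1 : measurableType d1) (T2 : measurableType d2) (R : realType).
Variables (m1 : {sigma_finite_measure set T1 -> \bar R}) (m2 : {sigma_finite_measure set T2 ->
  \bar R}).

Lemma ae_prod1 (P : T1 -> Prop) : {ae m1, forall x, P x} -> {ae (m1 \x m2)%E, forall z, P z.1}.
Proof.
move=> [N [mN N0 NP]]; exists (N `*` setT); split.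
- exact: measurableX.
- have := product_measure1E m1 m2 mN measurableT; by rewrite [X in (X * _)%E]N0 mul0e.
- by move=> z /= nP; split => //; exact: NP.
Qed.

Lemma ae_prod2 (P : T2 -> Prop) : {ae m2, forall x, P x} -> {ae (m1 \x m2)%E, forall z, P z.2}.
Proof.
move=> [N [mN N0 NP]]; exists (setT `*` N); split.
- exact: measurableX.
- have := product_measure1E m1 m2 measurableT mN; by rewrite [X in (_ * X)%E]N0 mule0.
- by move=> z /= nP; split => //; exact: NP.
Qed.

End ae_prod.

Section Rintegral_facts.
Context d (T : measurableType d) (R : realType) (m : {measure set T -> \bar R}).

(** At least one of the integrals of the positive and the negative part is
    infinite, and [fine] sends infinite values to [0]. *)
Lemma Rintegral_nonintegrable (h : T -> R) : measurable_fun setT h ->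
  ~ m.-integrable setT (EFin \o h) -> \int[m]_x h x = 0.
Proof.
move=> mh nh; have /measurable_EFinP mEh := mh.
rewrite /Rintegral integralE.
have A0 : (0 <= \int[m]_x (EFin \o h)^\+ x)%E by exact: integral_ge0.
have B0 : (0 <= \int[m]_x (EFin \o h)^\- x)%E by exact: integral_ge0.
have : (\int[m]_x (EFin \o h)^\+ x + \int[m]_x (EFin \o h)^\- x = +oo)%E.
  rewrite -ge0_integralD//; last 2 first.
  - exact: measurable_funepos.
  - exact: measurable_funeneg.
  apply: contrapT => /eqP; rewrite -ltey => h'; apply: nh; apply/integrableP; split => //.
  by under eq_integral do rewrite -/((abse \o (EFin \o h)) _) fune_abse.
move: A0 B0; case: (integral _ _ _) => [a||]; case: (integral _ _ _) => [b||] //=.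
Qed.

(** Both sides vanish if [h] is not integrable and [c] is not [0]. *)
Lemma Rintegral_mulr (h : T -> R) c : measurable_fun setT h ->
  \int[m]_x (c * h x) = c * \int[m]_x h x.
Proof.
move=> mh; have [->|c0] := eqVneq c 0.
  rewrite mul0r; under eq_Rintegral do rewrite mul0r.
  by rewrite Rintegral_cst// mul0r.
have [ih|nh] := pselect (m.-integrable setT (EFin \o h)); first exact: RintegralZl.
rewrite (Rintegral_nonintegrable mh nh) mulr0; apply: Rintegral_nonintegrable.
  exact: measurable_funM.
move=> ic; apply: nh.
have := integrableZl measurableT c^-1 ic; apply: eq_integrable => // x _ /=.
by rewrite -EFinM mulKf.
Qed.

Lemma abs_Rintegral_le (h : T -> R) :
  measurable_fun setT h -> (`|\int[m]_x h x|%:E <= \int[m]_x `|(h x)%:E|)%E.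
Proof.
move=> mh; apply: (@le_trans _ _ (`|\int[m]_x (h x)%:E|)%E); last first.
  by apply: le_abse_integral => //; exact/measurable_EFinP.
by rewrite /Rintegral; case: (integral _ _ _) => //=; rewrite normr0 leey.
Qed.

Lemma eq_ae_Rintegral (f h : T -> R) :
  measurable_fun setT f -> measurable_fun setT h ->
  {ae m, forall x, f x = h x} -> \int[m]_x f x = \int[m]_x h x.
Proof.
move=> mf mh fh; rewrite /Rintegral; congr fine; apply: ae_eq_integral => //.
- exact/measurable_EFinP.
- exact/measurable_EFinP.
by apply: filterS fh => x -> _.
Qed.

Lemma Rintegral_dominated (F : nat -> T -> R) (f G : T -> R) :
  (forall k, measurable_fun setT (F k)) -> measurable_fun setT f ->
  {ae m, forall x, F k x @[k --> \oo] --> f x} ->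
  m.-integrable setT (EFin \o G) ->
  {ae m, forall x k, `|F k x| <= G x} ->
  m.-integrable setT (EFin \o f) /\ \int[m]_x F k x @[k --> \oo] --> \int[m]_x f x.
Proof.
move=> mF mf Ff IG FG.
have [|||||If _ cv] := @dominated_convergence _ T R m setT measurableT
   (fun k x => (F k x)%:E) (fun x => (f x)%:E) (EFin \o G).
- by move=> k; exact/measurable_EFinP.
- exact/measurable_EFinP.
- by apply: filterS Ff => x h _; apply: cvg_EFin => //; near=> k.
- exact: IG.
- by apply: filterS FG => x h k _; rewrite /= lee_fin.
split=> //; rewrite /Rintegral; apply: fine_cvg; rewrite fineK; last exact: integrable_fin_num.
exact: cv.
Unshelve. all: by end_near. Qed.

End Rintegral_facts.

(** * Weak partial derivatives and increments *)

Section translations.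
Context {R : realType} {n : nat}.
Notation mu := (@lebesgue_rV R n).
Local Notation lam := (uniform_prob (@ltr01 R)).
Implicit Types (u g psi : 'rV[R]_n -> R) (e : 'rV[R]_n) (t : R).

Lemma pderiv_shift i psi c x : pderiv i (fun y => psi (y + c)) x = pderiv i psi (x + c).
Proof.
rewrite /pderiv /derive; apply: (congr1 (fun F : R -> R => lim (F h @[h --> 0^']))).
by apply/funext => h /=; rewrite addrA.
Qed.

Lemma Ck_shift k psi c : Ck k psi -> Ck k (fun y => psi (y + c)).
Proof.
elim: k psi => [|k IH] psi /=.
  move=> cp x; have h : differentiable (fun y : 'rV[R]_n => y + c) x by apply: differentiableD.
  exact: cvg_comp (differentiable_continuous h) (cp _).
move=> [dp pp]; split => [x|i].
  by apply: (@differentiable_comp _ _ _ _ (fun y => y + c) psi) => //; apply: differentiableD.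
rewrite (_ : pderiv _ _ = fun y => pderiv i psi (y + c)); first exact: IH.
by apply/funext => x; rewrite pderiv_shift.
Qed.

Lemma test_function_shift psi c : test_function psi -> test_function (fun y => psi (y + c)).
Proof.
move=> tp; have [M pM] := test_function_bounded tp; have [Cp _] := tp.
apply: (@test_functionP _ _ _ (M + `|c|)); first by move=> k; exact: Ck_shift.
move=> x /pM h; rewrite -[x](addrK c) (le_trans (ler_normB _ _))//.
by rewrite lerD2r.
Qed.

Lemma is_derive_line i psi x (t r : R) : (forall x, differentiable psi x) ->
  is_derive r 1 (fun r => psi (x + (r * t) *: delta_mx 0 i)) (t * pderiv i psi (x + (r *
    t) *: delta_mx 0 i)).
Proof.
move=> dp; set e := delta_mx 0 i; set y := x + _.
have E : (fun h : R => h^-1 *: (((fun r => psi (x + (r * t) *: e)) \o shift r) (h *: 1) - psi y))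
  = (fun h => h^-1 *: ((psi \o shift y) (h *: (t *: e)) - psi y)).
  apply/funext => h /=; congr (_ *: (psi _ - _)).
  by rewrite /y [h%:A]mulr1 mulrDl scalerDl -scalerA addrCA.
have dpy : derivable psi y (t *: e) by exact: diff_derivable.
apply: DeriveDef; first by rewrite /derivable E.
rewrite /derive E -/(derive psi y (t *: e)) deriveE// linearZ/=.
by rewrite /pderiv deriveE.
Qed.

Lemma ftc_line i psi x t : (forall x, differentiable psi x) -> continuous (pderiv i psi) ->
  psi (x + t *: delta_mx 0 i) - psi x =
  \int[lam]_r (t * pderiv i psi (x + (r * t) *: delta_mx 0 i)).
Proof.
move=> dp cp; set e := delta_mx 0 i.
have cl : continuous (fun r : R => x + (r * t) *: e : 'rV[R]_n).
  move=> r; apply: cvgD; first exact: cvg_cst.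
  by apply: cvgZr_tmp; apply: cvgM; [exact: cvg_id|exact: cvg_cst].
have cf : continuous (fun r : R => t * pderiv i psi (x + (r * t) *: e)).
  move=> r; apply: cvgM; first exact: cvg_cst.
  exact: cvg_comp (cl r) (cp _).
have d r := is_derive_line i x t r dp.
have cF : continuous (fun r : R => psi (x + (r * t) *: e)).
  move=> r; apply: differentiable_continuous; apply/derivable1_diffP;
    exact: (@ex_derive _ _ _ _ _ _ _ (d r)).
rewrite Rintegral_lam; last exact: continuous_measurable_fun.
rewrite /Rintegral (@continuous_FTC2 _ _ (fun r => psi (x + (r * t) *: e)))//=.
- by rewrite mul1r mul0r scale0r addr0.
- exact: continuous_subspaceT.
- split.
  + by move=> r _; exact: (@ex_derive _ _ _ _ _ _ _ (d r)).
  + exact: cvg_at_right_filter (cF 0).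
  + exact: cvg_at_left_filter (cF 1).
- by move=> r _; rewrite derive1E; exact: (@derive_val _ _ _ _ _ _ _ (d r)).
Qed.

Lemma measurable_translate e (s : R -> R) : measurable_fun setT s ->
  measurable_fun setT (fun z : R * 'rV[R]_n => z.2 + s z.1 *: e).
Proof.
move=> ms; apply: measurable_fun_rVP => i; under eq_fun do rewrite !mxE.
apply: measurable_funD.
  exact: (measurableT_comp (measurable_coord i) measurable_snd).
by apply: measurable_funM => //; exact: (measurableT_comp ms measurable_fst).
Qed.

Lemma norm_delta_le i : `|delta_mx 0 i : 'rV[R]_n| <= 1.
Proof.
rewrite [leLHS]mx_normrE; apply/bigmax_leP; split => // -[a b] _ /=.
by rewrite mxE; case: (_ && _); rewrite ?normr1 ?normr0.
Qed.

Lemma integral_translate_le g psi c (C M S : R) : loc_integrable g -> measurable_fun setT psi ->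
  (forall x, `|psi x| <= C) -> (forall x, psi x != 0 -> `|x| <= M) -> `|c| <= S ->
  (\int[mu]_x `|(psi x * g (x + c))%:E| <= C%:E * \int[mu]_(x in cball (M + S)) `|(g x)%:E|)%E.
Proof.
move=> lg mpsi pC pM cS.
have mg := loc_integrable_measurable lg.
have C0 : 0 <= C by exact: le_trans (pC 0).
pose G := (abse \o (EFin \o g)) \_ (cball (M + S)).
have mG : measurable_fun setT G.
  apply: (measurable_restrictT _ (measurable_cball _)).1 => //.
  by apply: measurableT_comp => //; apply: measurable_funTS; exact/measurable_EFinP.
have G0 x : (0 <= G x)%E by rewrite /G patchE; case: ifP => _; [exact: abse_ge0|exact: lexx].
rewrite [X in (_ <= _ * X)%E]integral_mkcond -/G -ge0_integralZl//.
rewrite -(@ge0_integral_shift _ _ c (fun x => C%:E * G x)%E); last 2 first.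
  - exact: measurable_funeM.
  - by move=> x; rewrite mule_ge0.
apply: ge0_le_integral => //.
- apply: measurableT_comp => //; apply/measurable_EFinP; apply: measurable_funM => //.
  exact: (measurableT_comp (f := g) mg (measurable_shift c)).
- apply: measurable_funeM; exact: measurableT_comp mG (measurable_shift _).
- move=> x _ /=; rewrite /G patchE; case: ifPn => [_|].
    by rewrite -EFinM lee_fin normrM ler_wpM2r.
  rewrite notin_setE => h.
  have [->|p0] := eqVneq (psi x) 0; first by rewrite mul0r normr0 mule_ge0.
  by exfalso; apply: h; rewrite /cball/= (le_trans (ler_normD _ _))// lerD// pM.
Qed.

(** By translation invariance, the integral over [x] at a fixed [r] is bounded
    by that of [|g|] over a ball which does not depend on [r]. *)
Lemma integrable_translates g (psi : R * 'rV[R]_n -> R) e (s : R -> R) (C M S : R) :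
  loc_integrable g -> measurable_fun setT psi -> measurable_fun setT s ->
  (forall r x, 0 <= r <= 1 -> `|psi (r, x)| <= C) ->
  (forall r x, 0 <= r <= 1 -> psi (r, x) != 0 -> `|x| <= M) ->
  (forall r, 0 <= r <= 1 -> `|s r *: e| <= S) ->
  (lam \x mu)%E.-integrable setT (EFin \o (fun z => psi z * g (z.2 + s z.1 *: e))).
Proof.
move=> lg mpsi ms pC pM sS.
have mg := loc_integrable_measurable lg.
have mf : measurable_fun setT (fun z : R * 'rV[R]_n => psi z * g (z.2 + s z.1 *: e)).
  by apply: measurable_funM => //; exact: measurableT_comp mg (measurable_translate e ms).
apply/integrable12ltyP; first exact/measurable_EFinP.
have Ig : mu.-integrable (cball (M + S)) (EFin \o g) by exact/lg/compact_cball.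
have [_ gfin] := integrableP _ _ _ Ig.
have C0 : 0 <= C by apply: le_trans (pC 0 0 _) => //; rewrite lexx ler01.
apply: (@le_lt_trans _ _ (C%:E * \int[mu]_(x in cball (M + S)) `|(g x)%:E|)%E); last first.
  by rewrite lte_mul_pinfty.
apply: integral_lam_le.
- apply: (measurable_fun_fubini_tonelli_F (m2 :=
    mu) (abse \o (EFin \o (fun z : R * 'rV[R]_n => psi z * g (z.2 + s z.1 *: e))))) => [|z];
      last exact: abse_ge0.
  by apply: measurableT_comp => //; exact/measurable_EFinP.
- by move=> r; exact: integral_ge0.
move=> r r01.
have h := @integral_translate_le g (fun x => psi (r, x)) (s r *: e) C M S lg
  (measurableT_comp mpsi (measurable_pair1 r)) (fun x => pC r x r01) (fun x =>
    pM r x r01) (sS r r01).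
exact: h.
Qed.

Lemma loc_integrableP u :
  (forall M, mu.-integrable setT (EFin \o (fun x => \1_(cball M) x * u x))) -> loc_integrable u.
Proof.
move=> h K cK; have [M [_ hM]] := compact_bounded cK.
have mK := compact_measurable_rV cK.
have sub : K `<=` cball (M + 1).
  by move=> x Kx; apply: hM => //; rewrite ltrDl.
have := integrableS measurableT mK (@subsetT _ K) (h (M + 1)).
apply: eq_integrable => // x; rewrite inE => Kx /=.
by rewrite indicE mem_set ?mul1r//; exact: sub.
Qed.

Lemma indic_cball_le M (x : 'rV[R]_n) : `|\1_(cball M) x : R| <= 1.
Proof. by rewrite indicE; case: (_ \in _); rewrite ?normr1 ?normr0. Qed.

Lemma indic_cball_supp M (x : 'rV[R]_n) : (\1_(cball M) x : R) != 0 -> `|x| <= M.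
Proof. by rewrite indicE; case: (boolP (_ \in _)) => [|_]; rewrite ?eqxx// inE. Qed.

Lemma loc_integrable_shift u c : loc_integrable u -> loc_integrable (fun x => u (x + c)).
Proof.
move=> lu; apply: loc_integrableP => M.
have I1 : mu.-integrable setT (EFin \o (fun y => u y * \1_(cball M) (y - c))).
  apply: (@loc_integrableM _ _ _ _ 1 (M + `|c|)) => //.
  - apply: (measurableT_comp (f := \1_(cball M) : 'rV[R]_n -> R)); last exact: measurable_shift.
    by apply: measurable_indic; exact: measurable_cball.
  - by move=> x; exact: indic_cball_le.
  - move=> x /indic_cball_supp h; rewrite -[x](subrK c) (le_trans (ler_normD _ _))//.
    by rewrite lerD2r.
have := integrable_shift c I1; apply: eq_integrable => // x _ /=.
by rewrite addrK mulrC.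
Qed.

(** The [i]-th component of [weak_gradient], taken alone because difference
    quotients work in one direction at a time. *)
Definition weak_partial i u g := [/\ loc_integrable u, loc_integrable g &
  forall psi, test_function psi ->
    \int[mu]_x (u x * pderiv i psi x) = - \int[mu]_x (g x * psi x)].

Lemma measurable_scaleM t : measurable_fun setT (fun r : R => r * t).
Proof. by apply: measurable_funM. Qed.

Lemma scale_delta_le i (r t : R) : 0 <= r <= 1 -> `|(r * t) *: (delta_mx 0 i : 'rV[R]_n)| <= `|t|.
Proof.
move=> /andP[r0 r1]; rewrite normrZ normrM (ger0_norm r0).
by rewrite mulrAC mulrC ler_piMr// mulr_ile1// norm_delta_le.
Qed.

Lemma integrable_average i g psi t : loc_integrable g -> measurable_fun setT psi ->
  (exists C M, (forall x, `|psi x| <= C) /\ (forall x, psi x != 0 -> `|x| <= M)) ->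
  (lam \x mu)%E.-integrable setT (EFin \o (fun z => psi z.2 * g (z.2 + (z.1 * t) *: delta_mx 0 i))).
Proof.
move=> lg mpsi [C [M [pC pM]]].
apply: (@integrable_translates g (fun z => psi z.2) _ (fun r => r * t) C M `|t|) => //.
- exact: measurableT_comp mpsi measurable_snd.
- exact: measurable_scaleM.
- by move=> r x _; exact: pM.
- by move=> r; exact: scale_delta_le.
Qed.

Lemma loc_integrable_average i g t : loc_integrable g ->
  loc_integrable (fun x => \int[lam]_r g (x + (r * t) *: delta_mx 0 i)).
Proof.
move=> lg; apply: loc_integrableP => M.
have h : exists C M0 : R, (forall x : 'rV[R]_n, `|\1_(cball M) x : R| <= C) /\
    (forall x : 'rV[R]_n, (\1_(cball M) x : R) != 0 -> `|x| <= M0).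
  by exists 1, M; split => x; [exact: indic_cball_le|exact: indic_cball_supp].
have := integrable_Rfubini2 (@integrable_average i g _ t lg (@measurable_indic _ _ R setT _
  (measurable_cball M)) h).
apply: eq_integrable => // x _ /=; congr EFin.
rewrite indicE; case: (_ \in _) => /=.
  by rewrite mul1r; apply: eq_Rintegral => r _; rewrite mul1r.
rewrite mul0r; under eq_Rintegral do rewrite mul0r.
by rewrite Rintegral_cst// mul0r.
Qed.

Lemma Rintegral_swap (F : R * 'rV[R]_n -> R) : (lam \x mu)%E.-integrable setT (EFin \o F) ->
  \int[mu]_x \int[lam]_r F (r, x) = \int[lam]_r \int[mu]_x F (r, x).
Proof. by move=> IF; rewrite (Rintegral_fubini2 IF) (Rintegral_fubini1 IF). Qed.

Lemma measurable_line g x i t : measurable_fun setT g ->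
  measurable_fun setT (fun r : R => g (x + (r * t) *: delta_mx 0 i)).
Proof.
move=> mg; have h := measurableT_comp mg (measurable_translate (delta_mx 0 i)
  (measurable_scaleM t)).
exact: measurableT_comp h (measurable_pair2 x).
Qed.

Lemma integrable_translated_weight i u psi t : loc_integrable u -> measurable_fun setT psi ->
  (exists C M, (forall x, `|psi x| <= C) /\ (forall x, psi x != 0 -> `|x| <= M)) ->
  (lam \x mu)%E.-integrable setT
    (EFin \o (fun z => psi (z.2 + (z.1 * t) *: delta_mx 0 i) * u z.2)).
Proof.
move=> lu mpsi [C [M [pC pM]]].
have h : (lam \x mu)%E.-integrable setT
    (EFin \o (fun z => psi (z.2 + (z.1 * t) *: delta_mx 0 i) *
      u (z.2 + (cst 0 z.1 : R) *: (0 : 'rV[R]_n)))).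
  apply: (@integrable_translates u (fun z =>
    psi (z.2 + (z.1 * t) *: delta_mx 0 i)) 0 (cst 0) C (M + `|t|) 0 lu) => //.
  - apply: measurableT_comp mpsi _.
    exact: measurable_translate (measurable_scaleM t).
  - move=> r x r01 /pM h; rewrite -[x](addrK ((r *
      t) *: delta_mx 0 i)) (le_trans (ler_normB _ _))//.
    by rewrite lerD// scale_delta_le.
  - by move=> r _; rewrite scaler0 normr0.
by apply: eq_integrable h => // z _ /=; rewrite scale0r addr0.
Qed.

(** Against a test function [psi], the left-hand side gives the integral of
    [u(x) (psi(x - t e) - psi(x))]. The increment of [psi] is the integral of
    its derivative along the segment, and the weak derivative of [u] may be
    used for each translate of [psi] on this segment, after an exchange of
    integrals. *)
Lemma weak_partial_increment i u g t : weak_partial i u g ->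
  {ae mu, forall x, u (x + t *: delta_mx 0 i) - u x =
    t * \int[lam]_r g (x + (r * t) *: delta_mx 0 i)}.
Proof.
move=> [lu lg ug]; set e := delta_mx 0 i.
pose f x := u (x + t *: e) - u x - t * \int[lam]_r g (x + (r * t) *: e).
have la := @loc_integrable_average i g t lg; rewrite -/e in la.
have ls := @loc_integrable_shift u (t *: e) lu.
have lta : loc_integrable (fun x => t * \int[lam]_r g (x + (r * t) *: e)).
  by apply: (@loc_integrableM_bounded _ _ _ (cst t) `|t| la).
suff : {ae mu, forall x, f x = 0}.
  by apply: filterS => x; rewrite /f => /eqP; rewrite subr_eq0 => /eqP.
apply: loc_integrable_ae0 => [|psi tp].
  by apply: loc_integrableB => //; exact: loc_integrableB.
have u_meas := loc_integrable_measurable lu.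
have mg := loc_integrable_measurable lg.
have mpsi := test_function_measurable tp.
have dp : forall x, differentiable psi x by have [C1 _] := tp; have [] := C1 1%N.
have tdp := pderiv_test_function i tp.
have ts := test_function_shift (- (t *: e)) tp.
have I1 := integrable_test ls tp; have I2 := integrable_test lu tp;
  have I3 := integrable_test lta tp.
have I4 := integrable_test lu ts.
have -> : \int[mu]_x (f x * psi x) =
  \int[mu]_x (u (x + t *: e) * psi x - u x * psi x - (t * \int[lam]_r g (x + (r * t) *: e)) *
    psi x).
  by apply: eq_Rintegral => x _; rewrite /f !mulrBl.
rewrite RintegralB//; last exact: (integrableB measurableT I1 I2).
rewrite RintegralB//.
have -> : \int[mu]_x (u (x + t *: e) * psi x) = \int[mu]_x (u x * psi (x - t *: e)).
  rewrite -[RHS](@Rintegral_shift _ _ (t *: e)).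
    by apply: eq_Rintegral => x _; rewrite addrK.
  by apply: measurable_funM => //; exact: test_function_measurable.
rewrite -RintegralB//.
have -> : \int[mu]_x (u x * psi (x - t *: e) - u x * psi x) =
   \int[mu]_x \int[lam]_r (- t * (pderiv i psi (x + (r * - t) *: e) * u x)).
  apply: eq_Rintegral => x _; rewrite -mulrBr -scaleNr ftc_line//; last first.
    exact: test_function_continuous.
  rewrite -Rintegral_mulr; last first.
    apply: measurable_funM => //; apply: measurable_line; exact: test_function_measurable.
  by apply: eq_Rintegral => r _; ring.
have J := @integrable_translated_weight i u _ (- t) lu (test_function_measurable tdp)
  (test_function_bound tdp); rewrite -/e in J.
have J' : (lam \x mu)%E.-integrable setT (EFin \o (fun z =>
  - t * (pderiv i psi (z.2 + (z.1 * - t) *: e) * u z.2))).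
  exact: (integrableZl measurableT (- t) J).
rewrite (Rintegral_swap J').
have K := @integrable_average i g psi t lg mpsi (test_function_bound tp); rewrite -/e in K.
have K' : (lam \x mu)%E.-integrable setT (EFin \o (fun z =>
  t * (psi z.2 * g (z.2 + (z.1 * t) *: e)))).
  exact: (integrableZl measurableT t K).
have -> : \int[mu]_x (t * (\int[lam]_r g (x + (r * t) *: e)) * psi x) =
   \int[mu]_x \int[lam]_r (t * (psi x * g (x + (r * t) *: e))).
  apply: eq_Rintegral => x _; rewrite mulrAC -Rintegral_mulr; last exact: measurable_line.
  by apply: eq_Rintegral => r _; rewrite mulrA.
rewrite (Rintegral_swap K') /=; apply/eqP; rewrite subr_eq0; apply/eqP.
apply: eq_Rintegral => r _.
have tsr := test_function_shift ((r * - t) *: e) tp.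
have -> : \int[mu]_x (- t * (pderiv i psi (x + (r * - t) *: e) * u x)) =
   - t * \int[mu]_x (u x * pderiv i (fun y => psi (y + (r * - t) *: e)) x).
  rewrite -RintegralZl//; last by apply: integrable_test => //; exact: pderiv_test_function.
  by apply: eq_Rintegral => x _; rewrite pderiv_shift; ring.
rewrite ug// mulrNN -Rintegral_mulr; last first.
  by apply: measurable_funM => //; exact: test_function_measurable.
rewrite -[LHS](@Rintegral_shift _ _ ((r * t) *: e)).
  by apply: eq_Rintegral => x _; rewrite mulrN scaleNr addrK; ring.
apply: measurable_funM => //; apply: measurable_funM => //; exact: test_function_measurable.
Qed.

End translations.

(** * Convergence of translates *)

Section tau.
Context {R : realType}.

(** Steps with a finite sum: for functions whose integrals are of order [tau k],
    convergence to [0] holds almost everywhere. *)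
Definition tau (k : nat) : R := (2 ^ (k + 1))%:R^-1.

Lemma tau_gt0 k : 0 < tau k.
Proof. by rewrite invr_gt0 ltr0n expn_gt0. Qed.

Lemma tau_le1 k : tau k <= 1.
Proof. by rewrite invf_le1 ?ltr0n ?expn_gt0// ler1n expn_gt0. Qed.

Lemma tau_series : (\sum_(0 <= k <oo) (tau k)%:E = 1 :> \bar R)%E.
Proof.
apply: cvg_lim => //.
have -> : (fun k => (\sum_(0 <= i < k) (tau i)%:E)%E) = eseries (fun k =>
  (1 / (2 ^ (k + 1))%:R)%:E : \bar R).
  by apply/funext => k; apply: eq_bigr => j _; rewrite div1r.
by have := @cvg_geometric_eseries_half R 1 0; rewrite expr0 divr1.
Qed.

Lemma tau_cvg0 : tau k @[k --> \oo] --> (0 : R).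
Proof.
apply: cvg_series_cvg_0; apply/cvg_ex; exists 1.
have -> : tau = (fun k => 1 / (2 ^ (k + 1))%:R).
  by apply/funext => k; rewrite div1r.
by have := @cvg_geometric_series_half R 1 0; rewrite expr0 divr1.
Qed.

End tau.

Section translates_cvg.
Context {R : realType} {n : nat}.
Notation mu := (@lebesgue_rV R n).
Local Notation lam := (uniform_prob (@ltr01 R)).
Implicit Types (u g psi : 'rV[R]_n -> R) (e : 'rV[R]_n) (t : R).

(** The integral of the absolute value of [weak_partial_increment] over a ball of
    radius [M]; the segments of length at most [1] stay in the ball of radius
    [M + 1]. *)
Lemma weak_partial_increment_bound i u g M (s : R) : weak_partial i u g -> `|s| <= 1 ->
  (\int[mu]_y `|(\1_(cball M) y * (u (y + s *: delta_mx 0 i) - u y))%:E| <=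
   `|s|%:E * \int[mu]_(x in cball (M + 1)) `|(g x)%:E|)%E.
Proof.
move=> wp s1; have [lu lg _] := wp; set e := delta_mx 0 i.
have u_meas := loc_integrable_measurable lu; have mg := loc_integrable_measurable lg.
have mM : measurable_fun setT (\1_(cball M) : 'rV[R]_n -> R).
  by apply: measurable_indic; exact: measurable_cball.
pose F (z : R * 'rV[R]_n) := \1_(cball M) z.2 * g (z.2 + (z.1 * s) *: e).
have mF : measurable_fun setT F.
  apply: measurable_funM; first exact: (measurableT_comp mM measurable_snd).
  exact: measurableT_comp mg (measurable_translate e (measurable_scaleM s)).
have mEF : measurable_fun setT (abse \o (EFin \o F)).
  by apply: measurableT_comp => //; exact/measurable_EFinP.
have mG : measurable_fun setT (fun y => \int[lam]_r `|(F (r, y))%:E|)%E.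
  exact: (measurable_fun_fubini_tonelli_G (m1 :=
    lam) (abse \o (EFin \o F)) mEF (fun z => abse_ge0 _)).
apply: (@le_trans _ _ (\int[mu]_y (`|s|%:E * \int[lam]_r `|(F (r, y))%:E|))%E).
  apply: ae_ge0_le_integral => //.
  - apply: measurableT_comp => //; apply/measurable_EFinP; apply: measurable_funM => //.
    by apply: measurable_funB => //; exact: (measurableT_comp (f := u) u_meas (measurable_shift _)).
  - by move=> x _; rewrite mule_ge0//; exact: integral_ge0.
  - exact: measurable_funeM.
  have := weak_partial_increment s wp; apply: filterS => y -> _.
  rewrite mulrCA -Rintegral_mulr; last exact: measurable_line.
  rewrite /= normrM EFinM lee_wpmul2l//.
  apply: abs_Rintegral_le.
  by apply: measurable_funM => //; exact: measurable_line.
rewrite ge0_integralZl//; last by move=> y _; exact: integral_ge0.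
rewrite lee_wpmul2l//.
rewrite -(fubini_tonelli (m1 := lam) (m2 := mu) (abse \o (EFin \o F)) mEF (fun z => abse_ge0 _)).
apply: integral_lam_le.
- exact: (measurable_fun_fubini_tonelli_F (m2 :=
    mu) (abse \o (EFin \o F)) mEF (fun z => abse_ge0 _)).
- by move=> r; apply: integral_ge0 => y _; exact: abse_ge0.
move=> r r01; rewrite -[leRHS]mul1e.
have h := @integral_translate_le _ _ g (\1_(cball M)) ((r * s) *: e) 1 M 1 lg mM
  (@indic_cball_le _ _ M) (@indic_cball_supp _ _ M) (le_trans (scale_delta_le i s r01) s1).
exact: h.
Qed.

(** The series of the increments converges almost everywhere, by summability of
    the steps. The factor [sg r] makes the lemma apply to both ends of the
    segment from [x - r t e] to [x + (1 - r) t e], simultaneously for almost all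
    [r] and [x]. *)
Lemma translates_cvg i u g (sg : R -> R) : weak_partial i u g -> measurable_fun setT sg ->
  (forall r, 0 <= r <= 1 -> `|sg r| <= 1) ->
  {ae (lam \x mu)%E, forall z, u (z.2 + (sg z.1 * tau k) *: delta_mx 0 i) @[k --> \oo] --> u z.2}.
Proof.
move=> wp msg sg1; have [lu lg _] := wp; set e := delta_mx 0 i.
have u_meas := loc_integrable_measurable lu.
suff h (M : nat) : {ae (lam \x mu)%E, forall z, `|z.2| <= M%:R ->
    u (z.2 + (sg z.1 * tau k) *: e) @[k --> \oo] --> u z.2}.
  have := ae_foralln h; apply: filterS => z hz.
  have [M _ zM] : (\bigcup_k cball k%:R) z.2 by rewrite bigcup_cball.
  exact: (hz M zM).
pose F k (z : R * 'rV[R]_n) := `|(\1_(cball M%:R) z.2 * (u (z.2 + (sg z.1 *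
  tau k) *: e) - u z.2))%:E|%E.
have mF k : measurable_fun setT (F k).
  apply: measurableT_comp => //; apply/measurable_EFinP; apply: measurable_funM.
    apply: (measurableT_comp (f := (\1_(cball M%:R) : 'rV[R]_n -> R)) _ measurable_snd).
    by apply: measurable_indic; exact: measurable_cball.
  apply: measurable_funB; last exact: (measurableT_comp u_meas measurable_snd).
  apply: measurableT_comp u_meas _.
  apply: (@measurable_translate _ _ e (fun r => sg r * tau k)).
  exact: measurable_funM.
have F0 k z : (0 <= F k z)%E by exact: abse_ge0.
have Ig : mu.-integrable (cball (M%:R + 1)) (EFin \o g) by exact/lg/compact_cball.
have [_ gfin] := integrableP _ _ _ Ig.
set C := (\int[mu]_(x in cball (M%:R + 1)) `|(EFin \o g) x|)%E in gfin.
have C0 : (0 <= C)%E by exact: integral_ge0.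
have FC k : (\int[lam \x mu]_z F k z <= (tau k)%:E * C)%E.
  have E : (\int[lam \x mu]_z F k z = \int[lam]_r \int[mu]_y F k (r, y))%E.
    exact: (fubini_tonelli1 (m1 := lam) (m2 := mu) (F k) (mF k) (F0 k)).
  rewrite E; apply: integral_lam_le.
  - exact: (measurable_fun_fubini_tonelli_F (m2 := mu) (F k) (mF k) (F0 k)).
  - by move=> r; exact: integral_ge0.
  move=> r r01; have st : `|sg r * tau k| <= tau k.
    by rewrite normrM (gtr0_norm (tau_gt0 k)) ler_piMl ?sg1// ltW// tau_gt0.
  apply: le_trans (@weak_partial_increment_bound i u g M%:R (sg r * tau k) wp _) _.
    by rewrite (le_trans st)// tau_le1.
  by rewrite lee_wpmul2r// lee_fin.
have : (\int[lam \x mu]_z \sum_(0 <= k <oo) F k z < +oo)%E.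
  rewrite integral_nneseries//.
  apply: (@le_lt_trans _ _ (\sum_(0 <= k <oo) ((tau k)%:E * C))%E).
    by apply: lee_nneseries => [k *|k *]; [exact: integral_ge0|exact: FC].
  have Cfin : C = (fine C)%:E by rewrite fineK// ge0_fin_numE.
  under eq_eseriesr do rewrite muleC Cfin.
  rewrite nneseriesZl; last by move=> k _; rewrite lee_fin ltW// tau_gt0.
  by rewrite tau_series mule1 ltry.
move=> Ifin.
have ISF : (lam \x mu)%E.-integrable setT (fun z => \sum_(0 <= k <oo) F k z)%E.
  apply/integrableP; split.
    exact: (@ge0_emeasurable_sum _ _ R setT F xpredT (fun k z _ _ => F0 k z) (fun k _ => mF k)).
  under eq_integral do rewrite gee0_abs ?nneseries_ge0//.
  exact: Ifin.
have := integrable_ae measurableT ISF; apply: filterS => z /(_ I) zfin zM.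
have Sfin : (\sum_(0 <= k <oo) F k z < +oo)%E by rewrite ltey_eq zfin.
have tl := nneseries_tail_cvg (P := xpredT) Sfin (fun k _ => F0 k z).
have Fz : (F k z) @[k --> \oo] --> 0%E.
  have nr : \forall k \near \oo, (0 <= F k z <= \sum_(k <= j <oo) F j z)%E.
    near=> k; rewrite F0/=.
    have := @nneseries_lim_ge R (F^~ z) xpredT k k.+1 (fun j _ _ => F0 j z).
    by rewrite big_nat1.
  by apply: (squeeze_cvge nr) => //; exact: cvg_cst.
have := @fine_cvg _ _ _ eventually_filter _ _ Fz.
have -> : fine \o (fun k => F k z) = (fun k => `|u (z.2 + (sg z.1 * tau k) *: e) - u z.2|).
  by apply/funext => k; rewrite /F /= indicE mem_set// mul1r.
by move=> /norm_cvg0P /subr_cvg0.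
Unshelve. all: by end_near. Qed.

End translates_cvg.

(** * Chain rule and product rule *)

Section chain.
Context {R : realType} {n : nat}.
Notation mu := (@lebesgue_rV R n).
Local Notation lam := (uniform_prob (@ltr01 R)).
Implicit Types (u v g psi : 'rV[R]_n -> R) (e : 'rV[R]_n) (t : R).

Lemma tau_shift_cvg e (x : 'rV[R]_n) (r : R) : x + (r * tau k) *: e @[k --> \oo] --> x.
Proof.
rewrite -[X in _ --> X]addr0 -(scale0r e) -(mulr0 r).
by apply: cvgD; [exact: cvg_cst|apply: cvgZr_tmp; apply: cvgMr; exact: tau_cvg0].
Qed.

Lemma test_function_tau_cvg psi e (x : 'rV[R]_n) (r : R) : test_function psi ->
  psi (x - (r * tau k) *: e) @[k --> \oo] --> psi x.
Proof.
move=> tp; have cs : x - (r * tau k) *: e @[k --> \oo] --> x.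
  by have := @tau_shift_cvg (- e) x r; under eq_fun do rewrite scalerN.
by apply: (continuous_cvg _ _ cs); exact: test_function_continuous.
Qed.

(** The difference quotient is the mean of [g] over a segment. A translation by
    [- r tau k] in the integral at a fixed [r] lets [g] stand alone and moves the
    weight [psi A_k] instead, whose convergence is the hypothesis. *)
Lemma difference_quotient_cvg i u g psi (A : nat -> 'rV[R]_n -> R) (B : 'rV[R]_n -> R) C :
  weak_partial i u g -> test_function psi ->
  (forall k, measurable_fun setT (A k)) -> measurable_fun setT B ->
  (forall k x, `|A k x| <= C) ->
  {ae (lam \x mu)%E, forall z, A k (z.2 - (z.1 * tau k) *: delta_mx 0 i) @[k --> \oo] --> B z.2} ->
  \int[mu]_x (psi x * A k x * ((tau k)^-1 * (u (x + tau k *: delta_mx 0 i) - u x))) @[k --> \oo] -->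
  \int[mu]_x (psi x * B x * g x).
Proof.
move=> wp tp mA mB AC AB; have [lu lg _] := wp; set e := delta_mx 0 i.
have u_meas := loc_integrable_measurable lu; have mg := loc_integrable_measurable lg.
have mpsi := test_function_measurable tp.
have [Cp [M [pC pM]]] := test_function_bound tp.
have C0 : 0 <= C by exact: le_trans (AC 0%N 0).
have Cp0 : 0 <= Cp by exact: le_trans (pC 0).
have mpA k : measurable_fun setT (fun x => psi x * A k x) by exact: measurable_funM.
have pAC k x : `|psi x * A k x| <= Cp * C by rewrite normrM ler_pM.
have pAM k x : psi x * A k x != 0 -> `|x| <= M.
  by rewrite mulf_eq0 negb_or => /andP[/pM].
pose F k (z : R * 'rV[R]_n) := psi (z.2 - (z.1 * tau k) *: e) * A k (z.2 - (z.1 * tau k) *: e) *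
  g z.2.
have mtr k : measurable_fun setT (fun z : R * 'rV[R]_n => z.2 - (z.1 * tau k) *: e).
  have := @measurable_translate R n e (fun r => r * - tau k) (measurable_scaleM _).
  by under eq_fun do rewrite mulrN scaleNr.
have mF k : measurable_fun setT (F k).
  apply: measurable_funM; last exact: (measurableT_comp mg measurable_snd).
  exact: (measurableT_comp (mpA k) (mtr k)).
have IF k : (lam \x mu)%E.-integrable setT (EFin \o F k).
  have := @integrable_translated_weight _ _ i g _ (- tau k) lg (mpA k).
  move=> h; have {h} : (lam \x mu)%E.-integrable setT
    (EFin \o (fun z : R * 'rV[R]_n => psi (z.2 + (z.1 * - tau k) *: e) * A k (z.2 + (z.1 *
      - tau k) *: e) * g z.2)).
    by apply: h; exists (Cp * C), M; split => x; [exact: pAC|exact: pAM].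
  by apply: eq_integrable => // z _; rewrite /F /= mulrN scaleNr.
have E k : \int[mu]_x (psi x * A k x * ((tau k)^-1 * (u (x + tau k *: e) - u x))) =
    \int[(lam \x mu)%E]_z F k z.
  have Ia : (lam \x mu)%E.-integrable setT
      (EFin \o (fun z : R * 'rV[R]_n => (psi z.2 * A k z.2) * g (z.2 + (z.1 * tau k) *: e))).
    apply: (integrable_average i _ lg (mpA k)).
    by exists (Cp * C), M; split => x; [exact: pAC|exact: pAM].
  transitivity (\int[mu]_x \int[lam]_r ((psi x * A k x) * g (x + (r * tau k) *: e))).
    apply: eq_ae_Rintegral.
    - apply: measurable_funM => //; apply: measurable_funM => //.
      by apply: measurable_funB => //; exact: (measurableT_comp (f :=
        u) u_meas (measurable_shift _)).
    - have /integrableP[] := integrable_Rfubini2 Ia.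
      by move=> /measurable_EFinP.
    have := weak_partial_increment (tau k) wp; apply: filterS => x ->.
    rewrite mulKf ?gt_eqF ?tau_gt0// -Rintegral_mulr//.
    exact: measurable_line.
  rewrite (Rintegral_swap Ia) -(Rintegral_fubini1 (IF k)).
  apply: eq_Rintegral => r _ /=.
  rewrite -[RHS](@Rintegral_shift _ _ ((r * tau k) *: e)).
    by apply: eq_Rintegral => x _; rewrite /F /= addrK.
  exact: measurableT_comp (mF k) (measurable_pair1 r).
under eq_fun do rewrite E.
pose G (z : R * 'rV[R]_n) := `|(Cp * C * \1_(cball (M + 1)) z.2) * g (z.2 + (z.1 * 0) *: e)|.
have [|||||If cv] := @Rintegral_dominated _ _ _ (lam \x mu)%E F (fun z =>
  psi z.2 * B z.2 * g z.2) G.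
- exact: mF.
- apply: measurable_funM; last exact: (measurableT_comp mg measurable_snd).
  apply: measurable_funM; first exact: (measurableT_comp mpsi measurable_snd).
  exact: (measurableT_comp mB measurable_snd).
- apply: ae_imp AB => z hz; apply: cvgMl; apply: cvgM => //.
  exact: test_function_tau_cvg.
- have h : exists C0 M0 : R, (forall x : 'rV[R]_n, `|Cp * C * \1_(cball (M + 1)) x| <= C0) /\
    (forall x : 'rV[R]_n, Cp * C * \1_(cball (M + 1)) x != 0 -> `|x| <= M0).
    exists (Cp * C), (M + 1); split => x.
      by rewrite normrM (ger0_norm (mulr_ge0 Cp0 C0)) ler_piMr ?mulr_ge0// indic_cball_le.
    by rewrite mulf_eq0 negb_or => /andP[_ /indic_cball_supp].
  have m1 : measurable_fun setT (fun x : 'rV[R]_n => Cp * C * \1_(cball (M + 1)) x).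
    by apply: measurable_funM => //; apply: measurable_indic; exact: measurable_cball.
  exact: integrable_abse (@integrable_average _ _ i g _ 0 lg m1 h).
- have := ae_prod1 mu (@lam_ae01 R); apply: ae_imp => z z01 k.
  rewrite /F /G mulr0 scale0r addr0 normrM [leRHS]normrM ler_wpM2r//.
  rewrite indicE; case: (boolP (_ \in _)) => [_|].
    by rewrite mulr1 (ger0_norm (mulr_ge0 Cp0 C0)) pAC.
  rewrite notin_setE /cball/= => h.
  rewrite mulr0 normr0 normr_le0; apply/eqP; apply: contrapT => /eqP /pAM h'.
  apply: h; rewrite -[z.2](subrK ((z.1 * tau k) *: e)) (le_trans (ler_normD _ _))// lerD//.
  by rewrite (le_trans (scale_delta_le _ _ z01))// gtr0_norm ?tau_gt0// tau_le1.
move: cv; rewrite -(Rintegral_fubini1 If) /=.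
rewrite Rintegral_cst// [X in fine X](_ : _ = 1%E) ?mulr1//; exact: (probability_setT lam).
Qed.

Lemma difference_quotient_le i psi Cd (t : R) x : test_function psi ->
  (forall x, `|pderiv i psi x| <= Cd) -> `|psi (x + t *: delta_mx 0 i) - psi x| <= `|t| * Cd.
Proof.
move=> tp hCd; have tdp := pderiv_test_function i tp.
have dp : forall x, differentiable psi x by have [C1 _] := tp; have [] := C1 1%N.
have ml := measurable_line x i t (test_function_measurable tdp).
have mtl : measurable_fun setT (fun r : R => t * pderiv i psi (x + (r * t) *: delta_mx 0 i)).
  exact: measurable_funM.
rewrite ftc_line//; last exact: test_function_continuous.
rewrite -lee_fin; apply: le_trans (@abs_Rintegral_le _ _ _ lam _ mtl) _.
apply: integral_lam_le => //.
  by apply: measurableT_comp => //; exact/measurable_EFinP.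
by move=> r _; rewrite lee_fin normrM ler_wpM2l.
Qed.

Lemma difference_quotient_pderiv i psi x : test_function psi ->
  (tau k)^-1 * (psi x - psi (x - tau k *: delta_mx 0 i)) @[k --> \oo] --> pderiv i psi x.
Proof.
move=> tp; have dp : forall x, differentiable psi x by have [C1 _] := tp; have [] := C1 1%N.
have : derivable psi x (delta_mx 0 i) by exact: diff_derivable.
have tn : (fun k => - tau k) @ \oo --> (0 : R)^'.
  move=> P [e /= e0 eP]; have := @tau_cvg0 R => /cvgrPdist_lt /(_ e e0) [N _ hN].
  exists N => // k /hN; rewrite /= sub0r normrN => tk; apply: eP; rewrite /= ?sub0r ?opprK//.
  by rewrite oppr_eq0 gt_eqF// tau_gt0.
move=> /(cvg_comp _ _ tn); rewrite -/(derive psi x (delta_mx 0 i)) -/(pderiv i psi x).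
apply: cvg_trans; apply: near_eq_cvg; near=> k => /=.
by rewrite invrN scaleNr -scalerN opprB scaleNr (addrC (- _)).
Unshelve. all: by end_near. Qed.

(** Here [f1] and [h1] are divided differences of [f] and [h], with the
    derivatives on the diagonal. The sets [U] and [V] hold the values of [u]
    and [v]: a power is Lipschitz only on a suitable range. The proof passes
    to the limit in the difference quotients of
    [f(u') h(v') - f(u) h(v) =
       f1(u',u) h(v') (u' - u) + f(u) h1(v',v) (v' - v)]. *)
Lemma weak_partial_comp_mul i u v gu gv (U V : set R) (f h : R -> R) (f1 h1 : R -> R -> R) (C : R) :
  weak_partial i u gu -> weak_partial i v gv ->
  (forall x, U (u x)) -> (forall x, V (v x)) ->
  measurable_fun setT f -> measurable_fun setT h ->
  measurable_fun setT (fun z : R * R => f1 z.1 z.2) ->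
  measurable_fun setT (fun z : R * R => h1 z.1 z.2) ->
  (forall a, U a -> `|f a| <= C) -> (forall b, V b -> `|h b| <= C) ->
  (forall a' a, U a' -> U a -> `|f1 a' a| <= C) ->
  (forall b' b, V b' -> V b -> `|h1 b' b| <= C) ->
  (forall a' a, U a' -> U a -> f a' - f a = f1 a' a * (a' - a)) ->
  (forall b' b, V b' -> V b -> h b' - h b = h1 b' b * (b' - b)) ->
  (forall (a' a : nat -> R) l, (forall k, U (a' k)) -> (forall k, U (a k)) -> U l ->
     a' k @[k --> \oo] --> l -> a k @[k --> \oo] --> l ->
       f1 (a' k) (a k) @[k --> \oo] --> f1 l l) ->
  (forall (b' b : nat -> R) l, (forall k, V (b' k)) -> (forall k, V (b k)) -> V l ->
     b' k @[k --> \oo] --> l -> b k @[k --> \oo] --> l ->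
       h1 (b' k) (b k) @[k --> \oo] --> h1 l l) ->
  weak_partial i (fun x => f (u x) * h (v x))
    (fun x => f1 (u x) (u x) * h (v x) * gu x + f (u x) * h1 (v x) (v x) * gv x).
Proof.
move=> wu wv Uu Vv mf mh mf1 mh1 fC hC f1C h1C fE hE f1c h1c.
pose e : 'rV[R]_n := delta_mx 0 i.
have [lu lgu _] := wu; have [lv lgv _] := wv.
have u_meas := loc_integrable_measurable lu; have v_meas := loc_integrable_measurable lv.
have C0 : 0 <= C by exact: le_trans (fC _ (Uu 0)).
have mfu : measurable_fun setT (f \o u) by exact: measurableT_comp.
have mhv : measurable_fun setT (h \o v) by exact: measurableT_comp.
have mus (c : 'rV[R]_n) : measurable_fun setT (fun x : 'rV[R]_n =>
  u (x + c)) by exact: (measurableT_comp (f := u) u_meas (measurable_shift c)).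
have mvs (c : 'rV[R]_n) : measurable_fun setT (fun x : 'rV[R]_n =>
  v (x + c)) by exact: (measurableT_comp (f := v) v_meas (measurable_shift c)).
have mf1u (c : 'rV[R]_n) : measurable_fun setT (fun x : 'rV[R]_n => f1 (u (x + c)) (u x)).
  exact: (measurableT_comp mf1 (measurable_fun_pair (mus c) u_meas)).
have mh1v (c : 'rV[R]_n) : measurable_fun setT (fun x : 'rV[R]_n => h1 (v (x + c)) (v x)).
  exact: (measurableT_comp mh1 (measurable_fun_pair (mvs c) v_meas)).
have mhvs (c : 'rV[R]_n) : measurable_fun setT (fun x : 'rV[R]_n =>
  h (v (x + c))) by exact: measurableT_comp mh (mvs c).
pose w x := f (u x) * h (v x).
pose A k x := f1 (u (x + tau k *: e)) (u x) * h (v (x + tau k *: e)).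
pose B k x := f (u x) * h1 (v (x + tau k *: e)) (v x).
pose A0 x := f1 (u x) (u x) * h (v x).
pose B0 x := f (u x) * h1 (v x) (v x).
have mw : measurable_fun setT w by exact: measurable_funM.
have mA k : measurable_fun setT (A k) by exact: measurable_funM.
have mB k : measurable_fun setT (B k) by exact: measurable_funM.
have mA0 : measurable_fun setT A0.
  by have := mf1u 0; under eq_fun do rewrite addr0; move=> h'; exact: measurable_funM.
have mB0 : measurable_fun setT B0.
  by have := mh1v 0; under eq_fun do rewrite addr0; move=> h'; exact: measurable_funM.
have wC x : `|w x| <= C * C by rewrite normrM ler_pM ?fC ?hC.
have AC k x : `|A k x| <= C * C by rewrite normrM ler_pM ?f1C ?hC.
have BC k x : `|B k x| <= C * C by rewrite normrM ler_pM ?h1C ?fC.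
have A0C x : `|A0 x| <= C * C by rewrite normrM ler_pM ?f1C ?hC.
have B0C x : `|B0 x| <= C * C by rewrite normrM ler_pM ?h1C ?fC.
have lw : loc_integrable w by exact: loc_integrable_bounded wC.
have lA := loc_integrableM_bounded lgu mA0 A0C.
have lB := loc_integrableM_bounded lgv mB0 B0C.
split => //; first exact: loc_integrableD lA lB.
move=> psi tp; have tdp := pderiv_test_function i tp.
have mpsi := test_function_measurable tp.
have [Cd [M' [hCd _]]] := test_function_bound tdp.
have Cd0 : 0 <= Cd by exact: le_trans (hCd 0).
have [Cp [M [hCp hM]]] := test_function_bound tp.
pose Q k x := (tau k)^-1 * (psi x - psi (x - tau k *: e)).
have mQ k : measurable_fun setT (Q k).
  apply: measurable_funM => //; apply: measurable_funB => //.
  exact: (measurableT_comp (f := psi) mpsi (measurable_shift _)).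
have QC k x : `|Q k x| <= Cd.
  rewrite /Q normrM gtr0_norm ?invr_gt0 ?tau_gt0// ler_pdivrMl ?tau_gt0//.
  have := difference_quotient_le (- tau k) x tp hCd.
  by rewrite scaleNr distrC normrN (gtr0_norm (tau_gt0 k)).
have QM k x : Q k x != 0 -> `|x| <= M + 1.
  apply: contraNT; rewrite -ltNge => Mx; rewrite /Q.
  have -> : psi x = 0.
    apply/eqP; apply: contraTT Mx => /hM xM; rewrite -leNgt (le_trans xM)// lerDl//.
  have -> : psi (x - tau k *: e) = 0.
    apply/eqP; apply: contraTT Mx => /hM xM; rewrite -leNgt -[x](subrK (tau k *: e)).
    rewrite (le_trans (ler_normD _ _))// lerD// -[tau k]mul1r (le_trans (scale_delta_le _ _ _))//.
      by rewrite ler01 lexx.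
    by rewrite gtr0_norm ?tau_gt0 ?tau_le1.
  by rewrite subr0 mulr0.
(* The limit of the same sequence is computed twice: with the difference quotient
   [Q k] on [psi] in [c1], and on [u] and [v] in [c2] and [c3]. *)
have c1 : \int[mu]_x (w x * Q k x) @[k --> \oo] --> \int[mu]_x (w x * pderiv i psi x).
  have IG : mu.-integrable setT (EFin \o (fun x => w x * (Cd * \1_(cball (M + 1)) x))).
    apply: (@loc_integrableM _ _ _ _ Cd (M + 1) lw).
    - by apply: measurable_funM => //; apply: measurable_indic; exact: measurable_cball.
    - by move=> x; rewrite normrM (ger0_norm Cd0) ler_piMr// indic_cball_le.
    - by move=> x; rewrite mulf_eq0 negb_or => /andP[_ /indic_cball_supp].
  apply: (@Rintegral_dominated _ _ _ mu _ _ (fun x =>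
    `|w x * (Cd * \1_(cball (M + 1)) x)|) _ _ _ _ _).2.
  - by move=> k; exact: measurable_funM.
  - by apply: measurable_funM => //; exact: test_function_measurable.
  - by apply: aeW => x; apply: cvgMr; exact: difference_quotient_pderiv.
  - exact: (integrable_abse IG).
  - apply: aeW => x k; rewrite normrM [leRHS]normrM ler_wpM2l//.
    have [->|/QM xM] := eqVneq (Q k x) 0; first by rewrite normr0.
    by rewrite indicE mem_set// mulr1 (ger0_norm Cd0).
have c2 := difference_quotient_cvg wu tp mA mA0 AC.
have c3 := difference_quotient_cvg wv tp mB mB0 BC.
have cvgshift (u0 g0 : 'rV[R]_n -> R) : weak_partial i u0 g0 ->
   {ae (lam \x mu)%E, forall z,
      u0 (z.2 - (z.1 * tau k) *: e) @[k --> \oo] --> u0 z.2 /\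
      u0 (z.2 - (z.1 * tau k) *: e + tau k *: e) @[k --> \oo] --> u0 z.2}.
  move=> w0.
  have m1 : measurable_fun setT (fun r : R => - r) by exact: measurable_funN.
  have m2 : measurable_fun setT (fun r : R => 1 - r) by exact: measurable_funB.
  have b1 (r : R) : 0 <= r <= 1 -> `|- r| <= 1 by rewrite ler_norml; lra.
  have b2 (r : R) : 0 <= r <= 1 -> `|1 - r| <= 1 by rewrite ler_norml; lra.
  have := ae_and (translates_cvg w0 m1 b1) (translates_cvg w0 m2 b2).
  apply: ae_imp => z [z1 z2]; split.
    by move: z1; under eq_fun do rewrite mulNr scaleNr.
  move: z2; apply: cvg_trans; apply: near_eq_cvg; near=> k.
  by rewrite mulrBl mul1r scalerBl addrA addrAC.
(* The weights [A k] and [B k] at [x - r tau k e] involve [u] and [v] at this point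
   and at [x + (1 - r) tau k e]. *)
have aeuv := ae_and (cvgshift _ _ wu) (cvgshift _ _ wv).
have lipc (U0 : set R) (f0 : R -> R) (f01 : R -> R -> R) :
    (forall a' a, U0 a' -> U0 a -> f0 a' - f0 a = f01 a' a * (a' - a)) ->
    (forall (a' a : nat -> R) l, (forall k, U0 (a' k)) -> (forall k, U0 (a k)) -> U0 l ->
     a' k @[k --> \oo] --> l -> a k @[k --> \oo] --> l ->
       f01 (a' k) (a k) @[k --> \oo] --> f01 l l) ->
    forall (a : nat -> R) l, (forall k, U0 (a k)) -> U0 l -> a k @[k --> \oo] --> l ->
    f0 (a k) @[k --> \oo] --> f0 l.
  move=> h0 h01 a l Ua Ul al; apply/subr_cvg0.
  have -> : (fun k => f0 (a k) - f0 l) = (fun k => f01 (a k) l * (a k - l)).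
    by apply/funext => k; exact: h0.
  rewrite -(mulr0 (f01 l l)); apply: cvgM; last exact/subr_cvg0.
  by apply: (h01 a (fun=> l)) => //; exact: cvg_cst.
have {}c2 := c2 (ae_imp _ aeuv); have {}c3 := c3 (ae_imp _ aeuv).
have {}c2 : \int[mu]_x (psi x * A k x * ((tau k)^-1 * (u (x + tau k *: e) - u x))) @[k --> \oo] -->
  \int[mu]_x (psi x * A0 x * gu x).
  apply: c2 => z [[u1 u2] [v1 v2]]; rewrite /A /A0; apply: cvgM.
    exact: f1c.
  exact: (lipc V h h1).
have {}c3 : \int[mu]_x (psi x * B k x * ((tau k)^-1 * (v (x + tau k *: e) - v x))) @[k --> \oo] -->
  \int[mu]_x (psi x * B0 x * gv x).
  apply: c3 => z [[u1 u2] [v1 v2]]; rewrite /B /B0; apply: cvgM.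
    exact: (lipc U f f1).
  exact: h1c.
have IpA k : mu.-integrable setT (EFin \o (fun x =>
  psi x * A k x * ((tau k)^-1 * (u (x + tau k *: e) - u x)))).
  have := @loc_integrableM _ _ (fun x => u (x + tau k *: e) - u x) (fun x =>
    psi x * A k x * (tau k)^-1)
     (Cp * (C * C) * (tau k)^-1) M.
  move=> H; apply: eq_integrable (H _ _ _ _) => //.
  - by move=> x _ /=; rewrite mulrC !mulrA.
  - by apply: loc_integrableB => //; exact: loc_integrable_shift.
  - by apply: measurable_funM => //; exact: measurable_funM.
  - move=> x; rewrite 2!normrM (gtr0_norm (x := (tau k)^-1)) ?invr_gt0 ?tau_gt0//.
    by rewrite ler_wpM2r ?invr_ge0 ?(ltW (tau_gt0 k))// ler_pM.
  - by move=> x; rewrite mulf_eq0 negb_or => /andP[+ _]; rewrite mulf_eq0 negb_or => /andP[/hM].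
have IpB k : mu.-integrable setT (EFin \o (fun x =>
  psi x * B k x * ((tau k)^-1 * (v (x + tau k *: e) - v x)))).
  have := @loc_integrableM _ _ (fun x => v (x + tau k *: e) - v x) (fun x =>
    psi x * B k x * (tau k)^-1)
     (Cp * (C * C) * (tau k)^-1) M.
  move=> H; apply: eq_integrable (H _ _ _ _) => //.
  - by move=> x _ /=; rewrite mulrC !mulrA.
  - by apply: loc_integrableB => //; exact: loc_integrable_shift.
  - by apply: measurable_funM => //; exact: measurable_funM.
  - move=> x; rewrite 2!normrM (gtr0_norm (x := (tau k)^-1)) ?invr_gt0 ?tau_gt0//.
    by rewrite ler_wpM2r ?invr_ge0 ?(ltW (tau_gt0 k))// ler_pM.
  - by move=> x; rewrite mulf_eq0 negb_or => /andP[+ _]; rewrite mulf_eq0 negb_or => /andP[/hM].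
have E k : \int[mu]_x (w x * Q k x) =
   - (\int[mu]_x (psi x * A k x * ((tau k)^-1 * (u (x + tau k *: e) - u x))) +
      \int[mu]_x (psi x * B k x * ((tau k)^-1 * (v (x + tau k *: e) - v x)))).
  rewrite -RintegralD//.
  have ws := loc_integrable_shift (tau k *: e) lw.
  have I1 := integrable_test ws tp; have I2 := integrable_test lw tp.
  have tps := test_function_shift (- (tau k *: e)) tp.
  have I3 := integrable_test lw tps.
  transitivity ((tau k)^-1 * (\int[mu]_x (w x * psi x) - \int[mu]_x (w x * psi (x - tau k *: e)))).
    rewrite -RintegralB// -RintegralZl//; last exact: (integrableB measurableT I2 I3).
    by apply: eq_Rintegral => x _; rewrite /Q; ring.
  have -> : \int[mu]_x (w x * psi (x - tau k *: e)) = \int[mu]_x (w (x + tau k *: e) * psi x).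
    rewrite -[LHS](@Rintegral_shift _ _ (tau k *: e)).
      by apply: eq_Rintegral => x _; rewrite addrK.
    by apply: measurable_funM => //; exact: test_function_measurable.
  rewrite -[X in X - _]opprK -opprD -[LHS]/(_ * _) mulrN; congr (- _).
  rewrite addrC -RintegralB// -RintegralZl//; last exact: (integrableB measurableT I1 I2).
  apply: eq_Rintegral => x _; rewrite /w /A /B.
  have := fE _ _ (Uu (x + tau k *: e)) (Uu x); have := hE _ _ (Vv (x + tau k *: e)) (Vv x).
  set hp := h (v (x + _)); set hm := h (v x); set fp := f (u (x + _)); set fm := f (u x).
  set h10 := h1 _ _; set f10 := f1 _ _; set t1 := (tau k)^-1.
  move=> e1 e2.
  have -> : psi x * (f10 * hp) * (t1 * (u (x + tau k *: e) - u x)) =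
     psi x * t1 * hp * (f10 * (u (x + tau k *: e) - u x)) by ring.
  have -> : psi x * (fm * h10) * (t1 * (v (x + tau k *: e) - v x)) =
     psi x * t1 * fm * (h10 * (v (x + tau k *: e) - v x)) by ring.
  by rewrite -e1 -e2; ring.
have c4 : \int[mu]_x (w x * Q k x) @[k --> \oo] -->
    - (\int[mu]_x (psi x * A0 x * gu x) + \int[mu]_x (psi x * B0 x * gv x)).
  under eq_fun do rewrite E.
  by apply: cvgN; apply: cvgD.
have -> : \int[mu]_x (f (u x) * h (v x) * pderiv i psi x) =
    - (\int[mu]_x (psi x * A0 x * gu x) + \int[mu]_x (psi x * B0 x * gv x)).
  exact: (cvg_unique _ c1 c4).
rewrite -RintegralD//; last 2 first.
- by have := integrable_test lA tp; apply: eq_integrable => // x _ /=; rewrite /A0; congr EFin;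
    ring.
- by have := integrable_test lB tp; apply: eq_integrable => // x _ /=; rewrite /B0; congr EFin;
    ring.
by congr (- _); apply: eq_Rintegral => x _; rewrite /A0 /B0; ring.
Unshelve. all: by end_near. Qed.

End chain.

(** * Divided differences *)

Section ddiff.
Context {R : realType}.

(** Completed by the derivative [F'] on the diagonal, where the quotient
    would be [0]. *)
Definition ddiff (F F' : R -> R) (a' a : R) : R :=
  if a' == a then F' a else (F a' - F a) / (a' - a).

Lemma ddiffE (F F' : R -> R) (a' a : R) : F a' - F a = ddiff F F' a' a * (a' - a).
Proof.
rewrite /ddiff; case: eqVneq => [->|h]; first by rewrite !subrr mulr0.
by rewrite divfK// subr_eq0.
Qed.

Lemma ddiff_diag (F F' : R -> R) (a : R) : ddiff F F' a a = F' a.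
Proof. by rewrite /ddiff eqxx. Qed.

Lemma measurable_invr : measurable_fun setT (@GRing.inv R).
Proof.
have -> : @GRing.inv R = fun x => x * (x * x) `^ (-1).
  apply/funext => x; rewrite powR_inv1 -?expr2 ?sqr_ge0//.
  have [->|x0] := eqVneq x 0; first by rewrite invr0 mul0r.
  by field; rewrite x0.
apply: measurable_funM; first exact: measurable_id.
have m2 : measurable_fun setT (fun x : R => x * x) by apply: measurable_funM.
exact: (measurableT_comp (measurable_powR (-1)) m2).
Qed.

Lemma measurable_ddiff (F F' : R -> R) : measurable_fun setT F -> measurable_fun setT F' ->
  measurable_fun setT (fun z : R * R => ddiff F F' z.1 z.2).
Proof.
move=> mF mF'; apply: measurable_fun_ifT.
- by apply: measurable_fun_eqr; [exact: measurable_fst|exact: measurable_snd].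
- exact: (measurableT_comp mF' measurable_snd).
apply: measurable_funM.
  by apply: measurable_funB; [exact: (measurableT_comp mF measurable_fst)|exact:
    (measurableT_comp mF measurable_snd)].
apply: (@measurableT_comp _ _ _ _ _ _ (@GRing.inv R)).
  exact: measurable_invr.
by apply: measurable_funB; [exact: measurable_fst|exact: measurable_snd].
Qed.

Variables (U : set R) (F F' : R -> R) (C : R).
Hypothesis Uc : forall a b x, U a -> U b -> a <= x <= b -> U x.
Hypothesis FF' : forall a b, U a -> U b -> a < b -> {within `[a, b], continuous F} /\
  forall x, x \in `]a, b[ -> is_derive x 1 F (F' x).
Hypothesis F'C : forall x, U x -> `|F' x| <= C.
Hypothesis F'c : forall (c : nat -> R) l, (forall k, U (c k)) -> U l ->
  c k @[k --> \oo] --> l -> F' (c k) @[k --> \oo] --> F' l.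

(** The mean value theorem. The intermediate point is close to every [l] to which
    both [a'] and [a] are close, whence the continuity of [ddiff] on the diagonal. *)
Lemma ddiff_mvt a' a l : U a' -> U a -> exists c, [/\ U c, ddiff F F' a' a = F' c &
  `|c - l| <= `|a' - l| + `|a - l|].
Proof.
have key x y : U x -> U y -> x < y -> exists c, [/\ U c, (F y - F x) / (y - x) = F' c &
    `|c - l| <= `|y - l| + `|x - l|].
  move=> Ux Uy xy; have [cF dF] := FF' Ux Uy xy.
  have [c cxy E] := MVT xy dF cF.
  exists c; move: cxy; rewrite in_itv/= => /andP[xc cy]; split.
  - by apply: (Uc Ux Uy); rewrite !ltW.
  - by rewrite E mulfK// subr_eq0 gt_eqF.
  - have := ler_norm (y - l); have := ler_norm (- (x - l)); rewrite normrN.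
    have := normr_ge0 (y - l); have := normr_ge0 (x - l); rewrite ler_norml; lra.
move=> Ua' Ua; rewrite /ddiff; case: (ltrgtP a' a) => [h|h|->].
- have [c [Uc' E cl]] := key _ _ Ua' Ua h; exists c; split => //; last by rewrite [leRHS]addrC.
  by rewrite -E -(opprB (F a)) -(opprB a) invrN mulrNN.
- have [c [Uc' E cl]] := key _ _ Ua Ua' h; exists c; split => //.
- by exists a; split => //; rewrite lerDl.
Qed.

Lemma ddiff_le a' a : U a' -> U a -> `|ddiff F F' a' a| <= C.
Proof. by move=> Ua' Ua; have [c [Uc' -> _]] := ddiff_mvt 0 Ua' Ua; exact: F'C. Qed.

Lemma ddiff_cvg (a' a : nat -> R) l : (forall k, U (a' k)) -> (forall k, U (a k)) -> U l ->
  a' k @[k --> \oo] --> l -> a k @[k --> \oo] --> l ->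
  ddiff F F' (a' k) (a k) @[k --> \oo] --> ddiff F F' l l.
Proof.
move=> Ua' Ua Ul cva' cva; rewrite ddiff_diag.
have /choice[c hc] : forall k, exists c, [/\ U c, ddiff F F' (a' k) (a k) = F' c &
    `|c - l| <= `|a' k - l| + `|a k - l|] by move=> k; exact: ddiff_mvt.
have -> : (fun k => ddiff F F' (a' k) (a k)) = F' \o c.
  by apply/funext => k; have [] := hc k.
apply: F'c => //; first by move=> k; have [] := hc k.
apply/subr_cvg0/norm_cvg0P.
have cv0 : `|a' k - l| + `|a k - l| @[k --> \oo] --> (0 : R).
  rewrite -[X in _ --> X]addr0; apply: cvgD; apply/norm_cvg0P; exact/subr_cvg0.
have nr : \forall k \near \oo, 0 <= `|c k - l| <= `|a' k - l| + `|a k - l|.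
  by near=> k; rewrite normr_ge0/=; have [] := hc k.
by apply: (squeeze_cvgr nr) => //; exact: cvg_cst.
Unshelve. all: by end_near. Qed.

End ddiff.

(** * Real powers and the discrete Picone inequality *)

Section powR_facts.
Context {R : realType}.
Implicit Types (p a x s : R).

Lemma powR_continuous_pos p x : 0 < x -> {for x, continuous (fun y : R => y `^ p)}.
Proof.
move=> x0; apply: differentiable_continuous; apply/derivable1_diffP.
by have [] := @is_derive1_powR R p x x0.
Qed.

(** The maximum is there because [y `^ p] is [1] for negative [y]. *)
Lemma powR_continuous0 p : 0 < p -> {for (0 : R), continuous (fun y : R => Num.max y 0 `^ p)}.
Proof.
move=> p0; apply/cvgrPdist_le => /= e e0.
have d0 : 0 < e `^ p^-1 by rewrite powR_gt0.
exists (e `^ p^-1) => //= y; rewrite /ball_/= sub0r normrN => yd.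
rewrite maxxx powR0 ?gt_eqF// sub0r normrN.
rewrite ger0_norm ?powR_ge0//.
have -> : e = (e `^ p^-1) `^ p by rewrite -powRrM mulVf ?gt_eqF// powRr1// ltW.
rewrite ge0_ler_powR ?nnegrE ?(ltW p0) ?(ltW d0)//; first by rewrite le_max lexx orbT.
by rewrite ge_max (ltW d0) (le_trans (ler_norm y) (ltW yd)).
Qed.

Lemma powR_seq_continuous p (c : nat -> R) (l : R) : 0 < p -> (forall k, 0 <= c k) -> 0 <= l ->
  c k @[k --> \oo] --> l -> c k `^ p @[k --> \oo] --> l `^ p.
Proof.
move=> p0 c0; rewrite le_eqVlt => /orP[/eqP <-|l0] cl; last first.
  apply: (@cvg_comp _ _ _ c (fun y : R => y `^ p) _ _ _ cl); exact: powR_continuous_pos.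
have := cvg_comp _ _ cl (powR_continuous0 p0).
rewrite maxxx; apply: cvg_trans; apply: near_eq_cvg; near=> k => /=.
by rewrite max_l.
Unshelve. all: by end_near. Qed.

(** Young's inequality for [x] and [s `^ (p - 1)], read as the statement that the
    convex function [x `^ p] lies above its tangent line at [s]. *)
Lemma powR_tangent p x s : 1 < p -> 0 <= x -> 0 <= s ->
  p * s `^ (p - 1) * x - (p - 1) * s `^ p <= x `^ p.
Proof.
move=> p1 x0 s0; have p0 : 0 < p by lra. have pm : 0 < p - 1 by lra.
have := @conjugate_powR R x (s `^ (p - 1)) p (p / (p - 1)) x0 (powR_ge0 _ _) p0 (divr_gt0 p0 pm).
have -> : p^-1 + (p / (p - 1))^-1 = 1 by field; rewrite !gt_eqF.
move=> /(_ erefl); rewrite -powRrM.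
have -> : (p - 1) * (p / (p - 1)) = p by field; rewrite gt_eqF.
have -> : s `^ p / (p / (p - 1)) = (p - 1) * s `^ p / p by field; rewrite !gt_eqF.
rewrite -mulrDl ler_pdivlMr//; lra.
Qed.

Lemma powR_split p x : 0 < x -> x `^ (p - 1) = x `^ p / x.
Proof. by move=> x0; rewrite powRB ?(gt_eqF x0) ?implybT// powRr1// ltW. Qed.

Lemma powR_split' p x : 0 < x -> x `^ (1 - p) = x / x `^ p.
Proof. by move=> x0; rewrite powRB ?(gt_eqF x0) ?implybT// powRr1// ltW. Qed.

Lemma signed_powE p x : 0 < x -> signed_pow p x = x `^ (p - 1).
Proof.
move=> x0; rewrite /signed_pow gtr0_norm// -{2}(powRr1 (ltW x0)) -powRD ?(gt_eqF x0) ?implybT//.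
by congr (_ `^ _); ring.
Qed.

Lemma signed_powN p x : signed_pow p (- x) = - signed_pow p x.
Proof. by rewrite /signed_pow normrN mulrN. Qed.

Lemma powR_div p a x : 0 <= a -> 0 < x -> (a / x) `^ p = a `^ p / x `^ p.
Proof.
move=> a0 x0; rewrite powRM ?invr_ge0 ?(ltW x0)//; congr (_ * _).
by rewrite -powR_inv1 ?(ltW x0)// -powRrM mulN1r powRN.
Qed.

(** For [B < A], set [X = A - B] and [d = |a - b|]. Then [a <= d + b] is the convex
    combination of [d A / X] and [b A / B] with weights [X / A] and [B / A]. The
    tangent line inequality at [a] for both points bounds [a^p] by the same
    combination of the [p]-th powers. *)
Lemma discrete_picone p a b A B : 1 < p -> 0 <= a -> 0 <= b -> 0 < A -> 0 < B ->
  signed_pow p (A - B) * (a `^ p * A `^ (1 - p) - b `^ p * B `^ (1 - p)) <= `|a - b| `^ p.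
Proof.
move=> p1 + + + +.
wlog BA : a b A B / B < A.
  move=> W a0 b0 A0 B0; case: (ltrgtP A B) => [AB|BA|->].
  - have := W b a B A AB b0 a0 B0 A0; rewrite distrC -(opprB B) signed_powN.
    by rewrite -(opprB (b `^ p * _)) mulrNN.
  - exact: W.
  - by rewrite subrr /signed_pow mulr0 mul0r powR_ge0.
move=> a0 b0 A0 B0; have X0 : 0 < A - B by rewrite subr_gt0.
set X := A - B in X0 *; set d := `|a - b|.
have d0 : 0 <= d by exact: normr_ge0.
have ad : a <= d + b by rewrite -lerBlDr ler_norm.
have p0 : 0 < p by lra.
rewrite signed_powE// powR_split// !powR_split'//.
have := @powR_tangent p (d * (A / X)) a p1 (mulr_ge0 d0 (ltW (divr_gt0 A0 X0))) a0.
have := @powR_tangent p (b * (A / B)) a p1 (mulr_ge0 b0 (ltW (divr_gt0 A0 B0))) a0.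
rewrite (powRM _ b0 (ltW (divr_gt0 A0 B0))) (powRM _ d0 (ltW (divr_gt0 A0 X0))) !(powR_div _
  (ltW A0))//.
have AP : 0 < A `^ p by rewrite powR_gt0.
have BP : 0 < B `^ p by rewrite powR_gt0.
have XP : 0 < X `^ p by rewrite powR_gt0.
have aE : a `^ (p - 1) * a = a `^ p.
  have [->|an0] := eqVneq a 0; first by rewrite mulr0 powR0// gt_eqF.
  by rewrite powR_split ?divfK// lt_def an0 a0.
have ap0 := powR_ge0 a (p - 1).
set am := a `^ (p - 1) in aE ap0 *; set ap := a `^ p in aE *; set bp := b `^ p; set dp := d `^ p.
move=> h1 h2.
(* [h2] and [h1] combined with the weights [X / A] and [B / A]. *)
have key : ap <= X / A * (dp * (A `^ p / X `^ p)) + B / A * (bp * (A `^ p / B `^ p)).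
  have XA : 0 < X / A by exact: divr_gt0.
  have BA' : 0 < B / A by exact: divr_gt0.
  have := ler_wpM2l (ltW XA) h2; have := ler_wpM2l (ltW BA') h1.
  have E1 : X / A * (p * am * (d * (A / X)) - (p - 1) * ap) = p * am * d - (p - 1) * ap * (X / A).
    by field; rewrite !gt_eqF.
  have E2 : B / A * (p * am * (b * (A / B)) - (p - 1) * ap) = p * am * b - (p - 1) * ap * (B / A).
    by field; rewrite !gt_eqF.
  rewrite E1 E2.
  have E3 : (p - 1) * ap * (X / A) + (p - 1) * ap * (B / A) = (p - 1) * ap.
    by rewrite /X; field; rewrite !gt_eqF.
  have E4 : p * ap <= p * am * d + p * am * b.
    by rewrite -aE mulrA -mulrDr ler_wpM2l// mulr_ge0// ltW.
  lra.
have K0 : 0 < X `^ p / X * (A / A `^ p) by rewrite mulr_gt0 ?divr_gt0.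
have := ler_wpM2l (ltW K0) key.
have E5 : X `^ p / X * (A / A `^ p) * (X / A * (dp * (A `^ p / X `^ p)) + B / A * (bp *
  (A `^ p / B `^ p))) =
   dp + X `^ p / X * (bp * (B / B `^ p)) by field; rewrite !gt_eqF.
rewrite E5 => h; rewrite mulrBr lerBlDr; apply: le_trans h.
by rewrite le_eqVlt; apply/orP; left; apply/eqP; ring.
Qed.

End powR_facts.

(** * Finsler norms and the local Picone inequality *)

Section dotv.
Context {R : realType} {n : nat}.
Implicit Types (x y z : 'rV[R]_n).

Lemma dotvDr x y z : dotv x (y + z) = dotv x y + dotv x z.
Proof. by rewrite /dotv -big_split; apply: eq_bigr => i _; rewrite mxE mulrDr. Qed.

Lemma dotvZr (a : R) x y : dotv x (a *: y) = a * dotv x y.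
Proof. by rewrite /dotv mulr_sumr; apply: eq_bigr => i _; rewrite mxE mulrCA. Qed.

Lemma dotvZl (a : R) x y : dotv (a *: x) y = a * dotv x y.
Proof. by rewrite /dotv mulr_sumr; apply: eq_bigr => i _; rewrite mxE mulrA. Qed.

Lemma dotv0l y : dotv 0 y = 0.
Proof. by rewrite -(scale0r 0) dotvZl mul0r. Qed.

Lemma dotv_grad (f : 'rV[R]_n -> R) x y : differentiable f x -> dotv (grad f x) y = 'D_y f x.
Proof.
move=> df; rewrite deriveE// [y in RHS]row_sum_delta linear_sum /dotv.
by apply: eq_bigr => i _; rewrite linearZ /= mxE /pderiv deriveE// mulrC.
Qed.

Lemma measurable_dotv d (T : measurableType d) (f g : T -> 'rV[R]_n) :
  measurable_fun setT f -> measurable_fun setT g -> measurable_fun setT (fun t => dotv (f t) (g t)).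
Proof.
move=> mf mg; apply: measurable_sum => i; apply: measurable_funM.
- exact: (measurableT_comp (measurable_coord i) mf).
- exact: (measurableT_comp (measurable_coord i) mg).
Qed.

Lemma measurable_continuous_off0 (f : 'rV[R]_n -> R) :
  (forall x, x != 0 -> {for x, continuous f}) -> measurable_fun setT f.
Proof.
move=> cf; apply: (measurability _ (RGenOInfty.measurableE R)).
move=> _ [_ [a ->] <-]; rewrite setTI.
have m0 : measurable [set (0 : 'rV[R]_n)].
  by apply: compact_measurable_rV; exact: compact_set1.
rewrite -(setUIDK (f @^-1` _) [set (0 : 'rV[R]_n)]); apply: measurableU.
  have [f0|f0] := pselect ((f @^-1` `]a, +oo[) 0).
    by rewrite setIidr//= => x ->.
  by rewrite (_ : _ `&` _ = set0)//; apply/seteqP; split => // x [fx /= x0]; apply: f0; rewrite -x0.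
apply: open_measurable_rV; rewrite openE => x [/= fx x0].
have xn0 : x != 0 by apply/eqP.
rewrite in_itv/= andbT in fx.
have nx0 : \forall y \near x, y <> 0.
  apply: open_nbhs_nbhs; split => //.
  by apply: closed_openC; have := @compact_set1 'rV[R]_n 0; exact: compact_closed.
near=> y; split; last by near: y.
by rewrite /= in_itv/= andbT; near: y; exact: (cvgr_gt _ (cf x xn0)).
Unshelve. all: by end_near. Qed.

End dotv.

Section finsler.
Context {R : realType} {n : nat} (H : 'rV[R]_n -> R).
Hypothesis FH : finsler_minkowski H.
Implicit Types (x y z xi eta : 'rV[R]_n).

Lemma finsler_ge0 x : 0 <= H x.
Proof. by have [[]] := FH. Qed.

Lemma finslerZ t x : H (t *: x) = `|t| * H x.
Proof. by have [[]] := FH. Qed.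

Lemma finsler0 : H 0 = 0.
Proof. by have [[_ _ H0 _] _] := FH; apply/H0. Qed.

(** Strict convexity covers the independent vectors, and homogeneity the others. *)
Lemma finslerD x y : H (x + y) <= H x + H y.
Proof.
have [_ [_ sub]] := FH.
have [/sub/ltW//|] := boolP (free [:: x; y]).
rewrite free_cons negb_and negbK span_seq1 seq1_free negbK => /orP[|/eqP ->].
  move=> /vlineP[k ->]; have -> : k *: y + y = (k + 1) *: y by rewrite scalerDl scale1r.
  rewrite !finslerZ; have := ler_wpM2r (finsler_ge0 y) (ler_normD k 1).
  by rewrite mulrDl normr1 mul1r.
by rewrite addr0 finsler0 addr0.
Qed.

Lemma finsler_differentiable x : x != 0 -> differentiable H x.
Proof. by move=> x0; have [[_ C _ _] _] := FH; have [] := C x x0. Qed.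

(** A directional derivative is also the limit from the right of its quotients. *)
Lemma derive_le_right (f : 'rV[R]_n -> R) x v (B : R) : differentiable f x ->
  (forall h, 0 < h < 1 -> f (h *: v + x) - f x <= h * B) -> 'D_v f x <= B.
Proof.
move=> df hB.
have dv : derivable f x v by exact: diff_derivable.
have cv := cvg_dnbhs_at_right dv.
have -> : 'D_v f x = lim (h^-1 *: (f (h *: v + x) - f x) @[h --> (0:R)^'+]).
  by rewrite (cvg_lim _ cv).
apply: limr_le; first by apply/cvg_ex; eexists; exact: cv.
near=> h; have h0 : 0 < h by near: h; exact: nbhs_right_gt.
have h1 : h < 1 by near: h; exact: nbhs_right_lt.
rewrite /GRing.scale/= mulrC ler_pdivrMr// mulrC; apply: hB; exact/andP.
Unshelve. all: by end_near. Qed.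

(** By subadditivity, [H (h eta + xi) - H xi <= h H eta]. *)
Lemma grad_finsler_le xi eta : xi != 0 -> dotv (grad H xi) eta <= H eta.
Proof.
move=> x0; have dH := finsler_differentiable x0; rewrite dotv_grad//.
apply: derive_le_right => // h /andP[h0 _].
by rewrite lerBlDr (le_trans (finslerD _ _))// lerD2r finslerZ gtr0_norm.
Qed.

(** Half of Euler's identity, by differentiation in the direction [- xi]. *)
Lemma grad_finsler_ge xi : xi != 0 -> H xi <= dotv (grad H xi) xi.
Proof.
move=> x0; have dH := finsler_differentiable x0.
rewrite -lerN2 -mulN1r -dotvZr scaleN1r dotv_grad//.
apply: derive_le_right => // h /andP[h0 h1].
have -> : h *: - xi + xi = (1 - h) *: xi by rewrite scalerN scalerBl scale1r addrC.
rewrite finslerZ ger0_norm; last by rewrite subr_ge0 ltW.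
by rewrite mulrBl mul1r addrAC subrr add0r mulrN.
Qed.

Lemma finsler_fieldE p xi : 1 < p -> finsler_field p H xi = H xi `^ (p - 1) *: grad H xi.
Proof.
move=> p1; rewrite /finsler_field; case: eqP => // ->.
by rewrite finsler0 powR0 ?scale0r// subr_eq0 gt_eqF.
Qed.

(** If [xi] and [eta] are the gradients of [v] and [u], and [w = u / v], the vector
    paired with the field is the gradient of [u^p / v^(p-1)]. The tangent line inequality
    is used at [w H xi]. *)
Lemma finsler_picone p xi eta (w : R) : 1 < p -> 0 <= w ->
  dotv (finsler_field p H xi) ((p * w `^ (p - 1)) *: eta - ((p - 1) * w `^ p) *: xi) <= H eta `^ p.
Proof.
move=> p1 w0; have p0 : 0 < p by lra.
rewrite /finsler_field; case: eqVneq => x0; first by rewrite dotv0l powR_ge0.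
have Hx0 : 0 < H xi.
  rewrite lt_def finsler_ge0 andbT; apply: contra x0 => /eqP Hx.
  by have [[_ _ H0 _] _] := FH; apply/eqP/H0.
rewrite dotvZl -scaleNr dotvDr !dotvZr.
have h1 := grad_finsler_le eta x0; have h2 := grad_finsler_ge x0.
have := powR_tangent p1 (finsler_ge0 eta) (mulr_ge0 w0 (ltW Hx0)).
rewrite !(powRM _ w0 (ltW Hx0)); apply: le_trans.
have E : H xi `^ p = H xi `^ (p - 1) * H xi by rewrite powR_split// divfK// gt_eqF.
rewrite E.
have K1 : 0 <= H xi `^ (p - 1) * (p * w `^ (p - 1)) by rewrite !mulr_ge0 ?powR_ge0// ltW.
have K2 : 0 <= H xi `^ (p - 1) * ((p - 1) * w `^ p).
  by rewrite !mulr_ge0 ?powR_ge0// subr_ge0 ltW.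
have := ler_wpM2l K1 h1; have := ler_wpM2l K2 h2; lra.
Qed.

Lemma measurable_finsler : measurable_fun setT H.
Proof.
by apply: measurable_continuous_off0 => x x0;
  exact/differentiable_continuous/finsler_differentiable.
Qed.

Lemma measurable_finsler_field p : 1 < p -> measurable_fun setT (finsler_field p H).
Proof.
move=> p1; apply: measurable_fun_rVP => i.
under eq_fun do rewrite finsler_fieldE// !mxE.
apply: measurable_funM; first exact: (measurableT_comp (measurable_powR _) measurable_finsler).
apply: measurable_continuous_off0 => x x0.
have [[_ C _ _] _] := FH; have [_ c] := C x x0.
have -> : pderiv i H = (fun y : 'rV[R]_n => y 0 i) \o grad H.
  by apply/funext => y; rewrite /= mxE.
by apply: continuous_comp => //; exact: coord_continuous.
Qed.

End finsler.

Section kernel.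
Context {R : realType} {n : nat}.

Lemma measurable_frac_kernel (p s : R) : measurable_fun setT (@frac_kernel R n p s).
Proof.
apply: (measurableT_comp (measurable_powR _)).
have md : measurable_fun setT (fun z : 'rV[R]_n * 'rV[R]_n => z.1 - z.2).
  apply: measurable_fun_rVP => i; under eq_fun do rewrite !mxE.
  by apply: measurable_funB; [exact: (measurableT_comp (measurable_coord i) measurable_fst)|
     exact: (measurableT_comp (measurable_coord i) measurable_snd)].
rewrite /enorm.
have ms : measurable_fun setT (@Num.sqrt R) by apply: continuous_measurable_fun;
  exact: sqrt_continuous.
exact: (measurableT_comp ms (measurable_dotv md md)).
Qed.

Lemma frac_kernel_ge0 (p s : R) z : 0 <= @frac_kernel R n p s z.
Proof. exact: powR_ge0. Qed.

Lemma measurable_signed_pow (p : R) : measurable_fun setT (signed_pow p).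
Proof.
apply: measurable_funM => //.
by apply: (measurableT_comp (measurable_powR _)); exact: normr_measurable.
Qed.

End kernel.

(** * Lebesgue and Sobolev functions *)

Section ae_integral.
Context d (T : measurableType d) (R : realType) (m : {measure set T -> \bar R}).

(** The positive parts are ordered as [f] and [g] and the negative parts in the
    opposite way, so that infinite integrals are covered. *)
Lemma ae_le_integral (D : set T) (f g : T -> \bar R) : measurable D ->
  measurable_fun D f -> measurable_fun D g ->
  {ae m, forall x, D x -> (f x <= g x)%E} ->
  (\int[m]_(x in D) f x <= \int[m]_(x in D) g x)%E.
Proof.
move=> mD mf mg fg; rewrite (integralE m D f) (integralE m D g); apply: leeB.
- apply: ae_ge0_le_integral => //; [exact: measurable_funepos|exact: measurable_funepos|].
  apply: ae_imp fg => x h Dx; have {}h := h Dx.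
  by rewrite !funeposE ge_max; apply/andP; split; rewrite le_max ?h ?lexx ?orbT.
- apply: ae_ge0_le_integral => //; [exact: measurable_funeneg|exact: measurable_funeneg|].
  apply: ae_imp fg => x h Dx; have {}h := h Dx.
  by rewrite !funenegE ge_max; apply/andP; split; rewrite le_max ?leeN2 ?h ?lexx ?orbT.
Qed.

Lemma ae_integral_ge0 (D : set T) (f : T -> \bar R) : measurable D ->
  measurable_fun D f -> {ae m, forall x, D x -> (0 <= f x)%E} ->
  (0 <= \int[m]_(x in D) f x)%E.
Proof.
move=> mD mf f0; have <- : (\int[m]_(x in D) (cst 0 x) = 0)%E by rewrite integral0.
exact: ae_le_integral.
Qed.

Lemma Lfun_powP (p : R) (f : T -> R) : 1 <= p -> f \in Lfun m p%:E <->
  measurable_fun setT f /\ m.-integrable setT (fun x => (`|f x| `^ p)%:E).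
Proof.
move=> p1; have p0 : 0 < p by apply: lt_le_trans p1.
split=> [h|[mf fi]].
  split; last exact: Lfun_integrable h.
  by move: h; rewrite inE => /andP[/[!inE]].
rewrite inE; apply/andP; split; rewrite inE//= /finite_norm.
have -> : ('N[m]_p%:E[EFin \o f] = (\int[m]_x (`|f x| `^ p)%:E) `^ p^-1)%E.
  rewrite unlock /Lnorm; congr (_ `^ _)%E.
apply: poweR_lty.
by have /integrableP[_] := fi; under eq_integral do rewrite gee0_abs ?lee_fin ?powR_ge0//.
Qed.

Lemma Lfun_dominated (p C : R) (f g h : T -> R) : 1 <= p -> 0 <= C ->
  measurable_fun setT f -> g \in Lfun m p%:E -> h \in Lfun m p%:E ->
  {ae m, forall x, `|f x| <= C * (`|g x| + `|h x|)} -> f \in Lfun m p%:E.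
Proof.
move=> p1 C0 mf /(Lfun_powP _ p1)[mg gi] /(Lfun_powP _ p1)[mh hi] fgh.
apply/Lfun_powP => //; split => //.
have p0 : 0 < p by apply: lt_le_trans p1.
have mp (k : T -> R) : measurable_fun setT k -> measurable_fun setT (fun x => (`|k x| `^ p)%:E).
  move=> mk; apply/measurable_EFinP; apply: (measurableT_comp (measurable_powR _)).
  exact: measurableT_comp.
have := integrableZl measurableT (((C * 2) `^ p)) (integrableD measurableT gi hi).
move=> /integrableP[_]; set G := (X in (\int[m]_x `|X x| < _)%E) => Goo.
apply/integrableP; split; first exact: mp.
apply: le_lt_trans Goo; apply: ae_ge0_le_integral => //.
- apply: (measurableT_comp (@abse_measurable R setT)); exact: mp.
- apply: (measurableT_comp (@abse_measurable R setT)).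
  apply: measurable_funeM; apply: emeasurable_funD; exact: mp.
- apply: ae_imp fgh => x fx _.
  rewrite /G !gee0_abs ?lee_fin ?powR_ge0 ?mule_ge0 ?adde_ge0 ?lee_fin ?powR_ge0//; last first.
    by rewrite mulr_ge0 ?addr_ge0 ?powR_ge0.
  (* [|g| + |h|] is at most twice the maximum, whose [p]-th power is at most the sum
     of the [p]-th powers. *)
  have gh : C * (`|g x| + `|h x|) <= C * 2 * Num.max `|g x| `|h x|.
    rewrite -mulrA ler_wpM2l// mulr_natl mulr2n lerD// le_max lexx ?orbT//.
  have M0 : 0 <= Num.max `|g x| `|h x| by rewrite le_max normr_ge0.
  apply: (@le_trans _ _ ((C * 2 * Num.max `|g x| `|h x|) `^ p)).
    rewrite ge0_ler_powR ?nnegrE ?(ltW p0)// ?mulr_ge0//.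
    exact: le_trans gh.
  rewrite powRM ?mulr_ge0// ler_wpM2l ?powR_ge0//.
  by case: (leP `|g x| `|h x|) => _; rewrite ?lerDl ?lerDr powR_ge0.
Qed.

End ae_integral.

Section sobolev_facts.
Context {R : realType} {n : nat}.
Notation mu := (@lebesgue_rV R n).
Implicit Types (u v f g : 'rV[R]_n -> R).

Lemma Lp_onT (q : \bar R) u : Lp_on setT q u = (u \in Lfun mu q).
Proof. by rewrite /Lp_on patch_setT. Qed.

Lemma Lp_on_measurable (A : set 'rV[R]_n) (q : \bar R) u : measurable A -> Lp_on A q u ->
  measurable_fun A u.
Proof.
move=> mA; rewrite /Lp_on inE => /andP[/[!inE]/= m _].
by apply/(measurable_restrictT _ mA).
Qed.

Lemma Lp_on_bounded (A : set 'rV[R]_n) u : Lp_on A +oo%E u ->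
  exists M : R, 0 <= M /\ {ae mu, forall x, A x -> `|u x| <= M}.
Proof.
rewrite /Lp_on inE => /andP[_ /[!inE]/=]; rewrite /finite_norm unlock /Lnorm.
case: ifPn => [mu0 /(@ess_supr_bounded _ _ _ mu) [M hM]|mu0 _].
  exists (Num.max M 0); split; first by rewrite le_max lexx orbT.
  apply: ae_imp hM => x /= + Ax; rewrite patchT ?inE// => h.
  by rewrite le_max h.
(* By convention the norm is [0] when the whole space is a null set. *)
exists 0; split => //; exists setT; split => //.
by apply/eqP; rewrite eq_le measure_ge0 andbT leNgt.
Qed.

Lemma loc_integrable_ae f g : loc_integrable f -> measurable_fun setT g ->
  {ae mu, forall x, f x = g x} -> loc_integrable g.
Proof.
move=> lf mg fg K cK; have mK := compact_measurable_rV cK.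
have mf := loc_integrable_measurable lf.
have mgK : measurable_fun K (EFin \o g) by apply/measurable_EFinP; exact: measurable_funTS.
have mfK : measurable_fun K (EFin \o f) by apply/measurable_EFinP; exact: measurable_funTS.
apply/integrableP; split => //.
have /integrableP[_] := lf K cK; apply: le_lt_trans.
apply: ae_le_integral => //; [exact: measurableT_comp|exact: measurableT_comp|].
by apply: ae_imp fg => x /= ->.
Qed.

Lemma weak_partial_ae i u v g : weak_partial i u g -> measurable_fun setT v ->
  {ae mu, forall x, u x = v x} -> weak_partial i v g.
Proof.
move=> [lu lg h] mv uv; have lv := loc_integrable_ae lu mv uv.
split=> // psi tpsi; rewrite -h//; apply: eq_ae_Rintegral.
- apply: measurable_funM => //; exact: (test_function_measurable (pderiv_test_function i tpsi)).
- apply: measurable_funM; first exact: loc_integrable_measurable.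
  exact: (test_function_measurable (pderiv_test_function i tpsi)).
- by apply: ae_imp uv => x ->.
Qed.

Lemma weak_partial_unique i u g g' : weak_partial i u g -> weak_partial i u g' ->
  {ae mu, forall x, g x = g' x}.
Proof.
move=> [lu lg h] [_ lg' h'].
have := loc_integrable_ae0 (loc_integrableB lg lg'); move=> H.
have {}H := H _; apply: ae_imp (H _) => [x /eqP|psi tpsi].
  by rewrite subr_eq0 => /eqP.
under eq_Rintegral do rewrite mulrBl.
rewrite (RintegralB measurableT (integrable_test lg tpsi) (integrable_test lg' tpsi)).
have := h psi tpsi; rewrite h'// => /oppr_inj ->; exact: subrr.
Qed.

Lemma weak_gradientP u (g : 'rV[R]_n -> 'rV[R]_n) : loc_integrable u ->
  weak_gradient u g <-> forall i, weak_partial i u (fun x => g x 0 i).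
Proof.
move=> lu; split=> [[_ lg h] i|h]; first by split=> // psi tpsi; exact: h.
by split=> // [i|psi tpsi i]; have [] := h i => // _ _; exact.
Qed.

Lemma wgradP u (g : 'rV[R]_n -> 'rV[R]_n) : weak_gradient u g -> weak_gradient u (wgrad u).
Proof. by move=> ug; apply: (@xgetPex _ _ [set g | weak_gradient u g]); exists g. Qed.

Lemma wgrad_unique u (g : 'rV[R]_n -> 'rV[R]_n) : weak_gradient u g ->
  {ae mu, forall x, wgrad u x = g x}.
Proof.
move=> ug; have [lu _ _] := ug.
have /(weak_gradientP _ lu) wu := wgradP ug; have /(weak_gradientP _ lu) wg := ug.
have : {ae mu, forall x, forall i, wgrad u x 0 i = g x 0 i}.
  have := @filter_forall _ _ (fun i x => wgrad u x 0 i = g x 0 i) (almost_everywhere mu) _.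
  by apply=> i; exact: weak_partial_unique (wu i) (wg i).
by apply: ae_imp => x h; apply/rowP => i; exact: h.
Qed.

Lemma wgrad_W1p p u : 1 <= p -> W1p p u ->
  weak_gradient u (wgrad u) /\ forall i, (fun x => wgrad u x 0 i) \in Lfun mu p%:E.
Proof.
move=> p1 [Lu [g ug Lg]]; have wu := wgradP ug; split => // i.
have [_ l _] := wu.
apply: (@Lfun_dominated _ _ _ _ p 1 _ (fun x => g x 0 i) (fun x => g x 0 i) p1 ler01).
- exact: loc_integrable_measurable (l i).
- by rewrite -Lp_onT.
- by rewrite -Lp_onT.
- by apply: ae_imp (wgrad_unique ug) => x ->; rewrite mul1r lerDl.
Qed.

Lemma measurable_wgrad u (g : 'rV[R]_n -> 'rV[R]_n) : weak_gradient u g ->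
  measurable_fun setT (wgrad u).
Proof.
move=> /wgradP[_ l _]; apply: measurable_fun_rVP => i.
exact: loc_integrable_measurable (l i).
Qed.

End sobolev_facts.

(** * The test function *)

Section factors.
Context {R : realType}.
Variable p : R.
Hypothesis p1 : 1 < p.
Implicit Types (a b x M e : R).

Let p0 : 0 < p. Proof. exact: lt_trans p1. Qed.
Let pm : 0 < p - 1. Proof. by rewrite subr_gt0. Qed.

Lemma powR_within a b : 0 <= a -> a < b -> {within `[a, b], continuous (fun x : R => x `^ p)}.
Proof.
move=> a0 ab; have b0 : 0 < b by exact: le_lt_trans ab.
apply/(continuous_within_itvP _ ab); split.
- move=> x; rewrite in_itv/= => /andP[ax _]; apply: powR_continuous_pos.
  exact: le_lt_trans ax.
- move: a0; rewrite le_eqVlt => /orP[/eqP a0|a0]; last first.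
    have c := @powR_continuous_pos R p a a0.
    by have := cvg_at_right_filter c.
  have := cvg_at_right_filter (powR_continuous0 p0); rewrite -a0 maxxx.
  apply: cvg_trans; apply: near_eq_cvg; near=> x => /=.
  rewrite max_l// ltW//; near: x; exact: nbhs_right_gt.
- have c := @powR_continuous_pos R p b b0.
  by have := cvg_at_left_filter c.
Unshelve. all: by end_near. Qed.

Definition powR' a := p * a `^ (p - 1).

Definition shift_powR e b := (b + e) `^ (1 - p).

Definition shift_powR' e b := (1 - p) * (b + e) `^ (- p).

Lemma powR_mono q a b : 0 <= q -> 0 <= a -> a <= b -> a `^ q <= b `^ q.
Proof.
by move=> q0 a0 ab; apply: ge0_ler_powR; rewrite ?nnegrE// (le_trans a0).
Qed.

Lemma powR_mono_neg q a b : 0 <= q -> 0 < a -> a <= b -> b `^ (- q) <= a `^ (- q).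
Proof.
move=> q0 a0 ab; have b0 : 0 < b by exact: lt_le_trans ab.
by rewrite !powRN lef_pV2 ?posrE ?powR_gt0// powR_mono// ltW.
Qed.

Lemma powR_FF' M a b : [set z | 0 <= z <= M] a -> [set z | 0 <= z <= M] b -> a < b ->
  {within `[a, b], continuous (fun x : R => x `^ p)} /\
  forall x, x \in `]a, b[ -> is_derive x 1 (fun x : R => x `^ p) (powR' x).
Proof.
move=> /= /andP[a0 _] _ ab; split; first exact: powR_within.
move=> x; rewrite in_itv/= => /andP[ax _]; apply: is_derive1_powR.
exact: le_lt_trans ax.
Qed.

Lemma powR'_le M a : 0 <= a <= M -> `|powR' a| <= p * M `^ (p - 1).
Proof.
move=> /andP[a0 aM]; rewrite ger0_norm; last by rewrite mulr_ge0 ?powR_ge0// ltW.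
by rewrite ler_wpM2l ?(ltW p0)// powR_mono// ltW.
Qed.

Lemma powR'_cvg M (c : nat -> R) (l : R) : (forall k, 0 <= c k <= M) -> 0 <= l <= M ->
  c k @[k --> \oo] --> l -> powR' (c k) @[k --> \oo] --> powR' l.
Proof.
move=> cM /andP[l0 _] cl; apply: cvgMr; apply: powR_seq_continuous => // k.
by have /andP[] := cM k.
Qed.

Lemma is_derive_shift_powR e b : 0 < b + e -> is_derive b 1 (shift_powR e) (shift_powR' e b).
Proof.
move=> be; have d1 := @is_derive1_powR R (1 - p) (b + e) be.
have d2 : is_derive b 1 (fun x : R => x + e) 1 by exact: is_derive_shift.
have := @is_derive1_comp R (fun y : R => y `^ (1 - p)) (fun x : R => x + e) b _ _ d1 d2;
  rewrite mulr1.
by rewrite (_ : 1 - p - 1 = - p)//; ring.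
Qed.

Lemma shift_powR_FF' e a b : 0 < e -> 0 <= a -> 0 <= b -> a < b ->
  {within `[a, b], continuous (shift_powR e)} /\
  forall x, x \in `]a, b[ -> is_derive x 1 (shift_powR e) (shift_powR' e x).
Proof.
move=> e0 a0 b0 ab; split.
  apply: derivable_within_continuous => x; rewrite in_itv/= => /andP[ax _].
  have xe : 0 < x + e by apply: ltr_wpDl => //; exact: le_trans ax.
  by have [] := is_derive_shift_powR xe.
move=> x; rewrite in_itv/= => /andP[ax _]; apply: is_derive_shift_powR.
by apply: ltr_wpDl => //; rewrite ltW// (le_lt_trans a0).
Qed.

Lemma shift_powR_le e b : 0 < e -> 0 <= b -> `|shift_powR e b| <= e `^ (1 - p).
Proof.
move=> e0 b0; rewrite ger0_norm ?powR_ge0// /shift_powR -opprB.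
by apply: powR_mono_neg; rewrite ?(ltW pm)// lerDr.
Qed.

Lemma shift_powR'_le e b : 0 < e -> 0 <= b -> `|shift_powR' e b| <= (p - 1) * e `^ (- p).
Proof.
move=> e0 b0; rewrite /shift_powR' normrM distrC (gtr0_norm pm) (ger0_norm (powR_ge0 _ _)).
by rewrite ler_wpM2l ?(ltW pm)// powR_mono_neg// ?(ltW p0)// lerDr.
Qed.

Lemma shift_powR'_cvg e (c : nat -> R) (l : R) : 0 < e -> (forall k, 0 <= c k) -> 0 <= l ->
  c k @[k --> \oo] --> l -> shift_powR' e (c k) @[k --> \oo] --> shift_powR' e l.
Proof.
move=> e0 c0 l0 cl; apply: cvgMr.
have cle : c k + e @[k --> \oo] --> l + e by apply: cvgD => //; exact: cvg_cst.
apply: (@cvg_comp _ _ _ (fun k => c k + e) (fun y : R => y `^ (- p)) _ _ _ cle).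
by apply: powR_continuous_pos; exact: ltr_wpDl.
Qed.

Lemma measurable_powR' : measurable_fun setT powR'.
Proof. by apply: measurable_funM => //; exact: measurable_powR. Qed.

Lemma measurable_shift_powR e : measurable_fun setT (shift_powR e).
Proof.
have ms : measurable_fun setT (fun b : R => b + e) by apply: measurable_funD.
exact: (measurableT_comp (measurable_powR _) ms).
Qed.

Lemma measurable_shift_powR' e : measurable_fun setT (shift_powR' e).
Proof.
have ms : measurable_fun setT (fun b : R => b + e) by apply: measurable_funD.
by apply: measurable_funM => //; exact: (measurableT_comp (measurable_powR _) ms).
Qed.

(** A common bound for both factors of the test function and their derivatives. *)
Definition picone_bound M e :=
  M `^ p + e `^ (1 - p) + p * M `^ (p - 1) + (p - 1) * e `^ (- p).

Lemma le_picone_bound M e : 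
  [/\ M `^ p <= picone_bound M e, e `^ (1 - p) <= picone_bound M e,
      p * M `^ (p - 1) <= picone_bound M e & (p - 1) * e `^ (- p) <= picone_bound M e].
Proof.
rewrite /picone_bound; have := powR_ge0 M p; have := powR_ge0 e (1 - p).
have := mulr_ge0 (ltW p0) (powR_ge0 M (p - 1)).
have := mulr_ge0 (ltW pm) (powR_ge0 e (- p)).
by split; lra.
Qed.

Lemma weak_partial_picone n (i : 'I_n) (u v gu gv : 'rV[R]_n -> R) M e :
  0 < e -> (forall x : 'rV[R]_n, 0 <= u x <= M) -> (forall x : 'rV[R]_n, 0 <= v x) ->
  weak_partial i u gu -> weak_partial i v gv ->
  weak_partial i (fun x : 'rV[R]_n => u x `^ p * shift_powR e (v x))
    (fun x : 'rV[R]_n => powR' (u x) * shift_powR e (v x) * gu x + u x `^ p *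
      shift_powR' e (v x) * gv x).
Proof.
move=> e0 uM v0 wu wv.
have [B1 B2 B3 B4] := le_picone_bound M e.
have Uc : forall a b x, [set z | 0 <= z <= M] a -> [set z | 0 <= z <= M] b -> a <= x <= b ->
    [set z | 0 <= z <= M] x.
  by move=> a b x /= /andP[a0 _] /andP[_ bM] /andP[ax xb];
    rewrite (le_trans a0 ax) (le_trans xb bM).
have Vc : forall a b x, [set z : R | 0 <= z] a -> [set z : R | 0 <= z] b -> a <= x <= b ->
    [set z : R | 0 <= z] x.
  by move=> a b x /= a0 _ /andP[ax _]; exact: le_trans ax.
have UF := @powR_FF' M.
have VF : forall a b : R, [set z : R | 0 <= z] a -> [set z : R | 0 <= z] b -> a < b ->
  {within `[a, b], continuous (shift_powR e)} /\
  forall x, x \in `]a, b[ -> is_derive x 1 (shift_powR e) (shift_powR' e x).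
  by move=> a b /= a0 b0; exact: shift_powR_FF'.
have := @weak_partial_comp_mul R n i u v gu gv [set z | 0 <= z <= M] [set z : R | 0 <= z]
  (fun x : R => x `^ p) (shift_powR e) (ddiff (fun x : R => x `^ p) powR')
  (ddiff (shift_powR e) (shift_powR' e)) (picone_bound M e) wu wv uM v0.
rewrite (_ : (fun y : 'rV[R]_n => ddiff (fun x : R => x `^ p) powR' _ _ * _ * _ + _) =
  (fun y => powR' (u y) * shift_powR e (v y) * gu y + u y `^ p * shift_powR' e (v y) * gv y));
    last first.
  by apply/funext => y; rewrite !ddiff_diag.
apply.
- exact: measurable_powR.
- exact: measurable_shift_powR.
- by apply: measurable_ddiff; [exact: measurable_powR|exact: measurable_powR'].
- by apply: measurable_ddiff; [exact: measurable_shift_powR|exact: measurable_shift_powR'].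
- move=> a /= /andP[a0 aM]; rewrite ger0_norm ?powR_ge0//; apply: le_trans B1.
  by apply: powR_mono => //; exact: ltW.
- by move=> b b0; apply: le_trans B2; exact: shift_powR_le.
- move=> a' a Ua' Ua; apply: le_trans B3.
  exact: (ddiff_le Uc UF (@powR'_le M) Ua' Ua).
- move=> b' b Vb' Vb; apply: le_trans B4.
  apply: (ddiff_le Vc VF _ Vb' Vb) => x; exact: shift_powR'_le.
- by move=> a' a _ _; exact: (ddiffE (fun x : R => x `^ p) powR').
- by move=> a' a _ _; exact: (ddiffE (shift_powR e) (shift_powR' e)).
- move=> a' a l Ua' Ua Ul; apply: (ddiff_cvg Uc UF _ Ua' Ua Ul) => c l'.
  exact: powR'_cvg.
- move=> b' b l Vb' Vb Vl; apply: (ddiff_cvg Vc VF _ Vb' Vb Vl) => c l'.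
  exact: shift_powR'_cvg.
Qed.

End factors.

Section clamp.
Context {R : realType}.
Implicit Types (a M : R).

Definition clamp M a := Num.min (Num.max a 0) M.

Lemma clamp_itv M a : 0 <= M -> 0 <= clamp M a <= M.
Proof. by move=> M0; rewrite le_min le_max lexx orbT M0 ge_min lexx orbT. Qed.

Lemma clamp_id M a : 0 <= a <= M -> clamp M a = a.
Proof. by move=> /andP[a0 aM]; rewrite /clamp max_l// min_l. Qed.

Lemma measurable_clamp M : measurable_fun setT (clamp M).
Proof.
apply: measurable_minr => //; exact: measurable_maxr.
Qed.

End clamp.

Section test.
Context {R : realType} {n : nat}.
Notation mu := (@lebesgue_rV R n).
Variables (Omega : set 'rV[R]_n) (p M e : R) (u v : 'rV[R]_n -> R).
Hypotheses (p1 : 1 < p) (M0 : 0 <= M) (e0 : 0 < e).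
Hypotheses (Wu : W01p Omega p u) (Wv : W01p Omega p v).
Hypothesis uM : {ae mu, forall x, 0 <= u x <= M}.
Hypothesis v0 : {ae mu, forall x, 0 <= v x}.

(** The function [u^p / (v + e)^(p-1)]. The truncations alter [u] and [v] on null
    sets only; they put all the values in the ranges where the powers are
    Lipschitz. *)
Definition picone_test (x : 'rV[R]_n) := clamp M (u x) `^ p * shift_powR p e (Num.max (v x) 0).

Let p0 : 0 < p. Proof. exact: lt_trans p1. Qed.
Let p1' : 1 <= p. Proof. exact: ltW. Qed.
Let pm : 0 < p - 1. Proof. by rewrite subr_gt0. Qed.

Let Lu : u \in Lfun mu p%:E. Proof. by have [[]] := Wu; rewrite Lp_onT. Qed.
Let Lv : v \in Lfun mu p%:E. Proof. by have [[]] := Wv; rewrite Lp_onT. Qed.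
Let u_meas : measurable_fun setT u. Proof. by have /(Lfun_powP _ _ p1')[] := Lu. Qed.
Let v_meas : measurable_fun setT v. Proof. by have /(Lfun_powP _ _ p1')[] := Lv. Qed.

Lemma measurable_picone_test : measurable_fun setT picone_test.
Proof.
apply: measurable_funM.
  apply: (measurableT_comp (measurable_powR _)).
  exact: (measurableT_comp (@measurable_clamp R M) u_meas).
apply: (measurableT_comp (measurable_shift_powR p e)).
exact: measurable_maxr.
Qed.

Lemma picone_test_ge0 x : 0 <= picone_test x.
Proof. by rewrite mulr_ge0 ?powR_ge0. Qed.

Lemma ae_picone_test : {ae mu, forall x, [/\ 0 <= u x <= M, 0 <= v x &
  picone_test x = u x `^ p * shift_powR p e (v x)]}.
Proof.
apply: ae_imp (ae_and uM v0) => x [ux vx].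
by rewrite /picone_test clamp_id// max_l.
Qed.

Let B := picone_bound p M e.

Let B0 : 0 <= B.
Proof. by have [h _ _ _] := le_picone_bound p1 M e; apply: le_trans h; exact: powR_ge0. Qed.

Definition picone_test_grad (x : 'rV[R]_n) : 'rV[R]_n :=
  (powR' p (clamp M (u x)) * shift_powR p e (Num.max (v x) 0)) *: wgrad u x +
  (clamp M (u x) `^ p * shift_powR' p e (Num.max (v x) 0)) *: wgrad v x.

Let mvt : measurable_fun setT (fun x => Num.max (v x) 0).
Proof. exact: measurable_maxr. Qed.

Let mut : measurable_fun setT (fun x => clamp M (u x)).
Proof. exact: (measurableT_comp (@measurable_clamp R M) u_meas). Qed.

Lemma weak_gradient_picone_test : weak_gradient picone_test picone_test_grad.
Proof.
have [B1 B2 B3 B4] := le_picone_bound p1 M e.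
have lphi : loc_integrable picone_test.
  apply: (@loc_integrable_bounded _ _ _ (B * B) measurable_picone_test) => x.
  rewrite normrM ler_pM ?normr_ge0//; last first.
    apply: le_trans B2; apply: shift_powR_le => //; by rewrite le_max lexx orbT.
  have /andP[c0 cM] := clamp_itv (u x) M0.
  by rewrite ger0_norm ?powR_ge0// (le_trans _ B1)// powR_mono// ltW.
apply/weak_gradientP => // i.
have [wgu _] := wgrad_W1p p1' (proj1 Wu); have [wgv _] := wgrad_W1p p1' (proj1 Wv).
have [lu _ _] := wgu; have [lv _ _] := wgv.
have /(weak_gradientP _ lu)/(_ i) wu := wgu; have /(weak_gradientP _ lv)/(_ i) wv := wgv.
have wut : weak_partial i (fun x => clamp M (u x)) (fun x => wgrad u x 0 i).
  apply: weak_partial_ae wu mut _; apply: ae_imp uM => x ux; by rewrite clamp_id.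
have wvt : weak_partial i (fun x => Num.max (v x) 0) (fun x => wgrad v x 0 i).
  apply: weak_partial_ae wv mvt _; apply: ae_imp v0 => x vx; by rewrite max_l.
have := @weak_partial_picone R p p1 n i _ _ _ _ M e e0 (fun x => clamp_itv (u x) M0) _ wut wvt.
have -> : (fun x => picone_test_grad x 0 i) = fun x =>
    powR' p (clamp M (u x)) * shift_powR p e (Num.max (v x) 0) * wgrad u x 0 i +
    clamp M (u x) `^ p * shift_powR' p e (Num.max (v x) 0) * wgrad v x 0 i.
  by apply/funext => x; rewrite /picone_test_grad !mxE.
by apply => x; rewrite le_max lexx orbT.
Qed.

Lemma W01p_picone_test : W01p Omega p picone_test.
Proof.
have [B1 B2 B3 B4] := le_picone_bound p1 M e.
split; last first.
  apply: ae_imp (ae_and (proj2 Wu) ae_picone_test) => x [ux [_ _ ->]] nO.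
  by rewrite ux// powR0 ?gt_eqF// mul0r.
have [wgu Lgu] := wgrad_W1p p1' (proj1 Wu); have [wgv Lgv] := wgrad_W1p p1' (proj1 Wv).
split.
  rewrite Lp_onT; apply: (Lfun_dominated p1' (mulr_ge0 (powR_ge0 M (p - 1)) (powR_ge0 e (1 - p)))
    measurable_picone_test Lu Lv).
  apply: ae_imp ae_picone_test => x [/andP[u0 uM'] vx ->].
  rewrite normrM !ger0_norm ?powR_ge0//.
  apply: (@le_trans _ _ (M `^ (p - 1) * u x * e `^ (1 - p))).
    rewrite ler_pM ?powR_ge0//; last first.
      by have := shift_powR_le p1 e0 vx; rewrite ger0_norm ?powR_ge0.
    move: (u0); rewrite le_eqVlt => /orP[/eqP <-|up]; first by rewrite powR0 ?gt_eqF// mulr0.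
    have -> : u x `^ p = u x `^ (p - 1) * u x by rewrite powR_split// divfK// gt_eqF.
    by rewrite ler_wpM2r// powR_mono// ltW.
  rewrite mulrAC ler_wpM2l ?mulr_ge0 ?powR_ge0//.
  by rewrite lerDl.
exists picone_test_grad; first exact: weak_gradient_picone_test.
move=> i; rewrite Lp_onT.
have [_ mg _] := weak_gradient_picone_test.
apply: (Lfun_dominated p1' (mulr_ge0 B0 B0) _ (Lgu i) (Lgv i)).
  exact: loc_integrable_measurable (mg i).
apply: nearW => x; rewrite /picone_test_grad !mxE.
have /andP[c0 cM] := clamp_itv (u x) M0.
have v0' : 0 <= Num.max (v x) 0 by rewrite le_max lexx orbT.
apply: le_trans (ler_normD _ _) _; rewrite mulrDr; apply: lerD; rewrite normrM ler_wpM2r// normrM.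
  apply: ler_pM => //.
    by apply: le_trans B3; exact: (powR'_le p1 (clamp_itv _ M0)).
  by apply: le_trans B2; exact: shift_powR_le.
apply: ler_pM => //.
  by rewrite ger0_norm ?powR_ge0// (le_trans _ B1)// powR_mono// ltW.
by apply: le_trans B4; exact: shift_powR'_le.
Qed.

(** The chain rule in the form to which [finsler_picone] applies. *)
Lemma wgrad_picone_test : {ae mu, forall x, let w := u x / (v x + e) in 0 <= w /\
  wgrad picone_test x = (p * w `^ (p - 1)) *: wgrad u x - ((p - 1) * w `^ p) *: wgrad v x}.
Proof.
apply: ae_imp (ae_and (wgrad_unique weak_gradient_picone_test) (ae_and uM v0)) => x [-> [ux vx]].
have /andP[u0 _] := ux; have ve : 0 < v x + e by exact: ltr_wpDl.
split; first exact: divr_ge0 (ltW ve).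
rewrite /picone_test_grad clamp_id// max_l// !powR_div//.
rewrite /powR' /shift_powR /shift_powR'; congr (_ *: _ + _).
  have -> : 1 - p = - (p - 1) by rewrite opprB.
  by rewrite powRN mulrA.
rewrite -scaleNr; congr (_ *: _); rewrite powRN; ring.
Qed.

End test.

(** * The energy inequality *)

(** Infinite values are covered because [+oo - +oo] is [-oo]. *)
Lemma le_of_sube_ge0 (R : realType) (a z : \bar R) : (0 <= a - z -> z <= a)%E.
Proof.
case: a => [a| |]; case: z => [z| |] //=; rewrite ?leey ?leNye//.
by rewrite -EFinB !lee_fin subr_ge0.
Qed.

Section estimate.
Context {R : realType} {n : nat}.
Notation mu := (@lebesgue_rV R n).
Variables (Omega : set 'rV[R]_n) (p s : R) (H g1 g2 : 'rV[R]_n -> R).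
Hypotheses (p1 : 1 < p) (oO : open Omega) (FH : finsler_minkowski H).
Hypotheses (g1_Loo : Lp_on Omega +oo%E g1) (g2_m : measurable_fun Omega g2).
Hypothesis g2_ge0 : {ae mu, forall x, Omega x -> 0 <= g2 x}.
Variables (M : R) (u v : 'rV[R]_n -> R).
Hypotheses (M0 : 0 <= M) (Wu : W01p Omega p u).
Hypothesis uM : {ae mu, forall x, 0 <= u x <= M}.
Hypothesis v_super : weak_supersolution Omega p s H g1 g2 v.
Hypothesis v0 : {ae mu, forall x, 0 <= v x}.
Hypothesis v_gt0 : ae_positive Omega v.

Let p1' : 1 <= p. Proof. exact: ltW. Qed.
Let pm : 0 < p - 1. Proof. by rewrite subr_gt0. Qed.
Let mO : measurable Omega. Proof. exact: open_measurable_rV. Qed.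
Let Wv : W01p Omega p v. Proof. by case: v_super. Qed.

Let u_meas : measurable_fun setT u.
Proof. by have [[/Lp_on_measurable]] := Wu => /(_ measurableT). Qed.
Let v_meas : measurable_fun setT v.
Proof. by have [[/Lp_on_measurable]] := Wv => /(_ measurableT). Qed.
Let mgu : measurable_fun setT (wgrad u).
Proof. by have [[_ [g /measurable_wgrad]]] := Wu. Qed.
Let mgv : measurable_fun setT (wgrad v).
Proof. by have [[_ [g /measurable_wgrad]]] := Wv. Qed.
Let mg1 : measurable_fun Omega g1.
Proof. exact: Lp_on_measurable g1_Loo. Qed.

Let Ea := (\int[mu]_(x in Omega) (H (wgrad u x) `^ p)%:E)%E.
Let Eb := (\int[mu \x mu]_z (`|u z.1 - u z.2| `^ p * frac_kernel p s z)%:E)%E.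

Section test.
Variable e : R.
Hypothesis e0 : 0 < e.

Let phi := picone_test p M e u v.
Let mphi : measurable_fun setT phi. Proof. exact: (measurable_picone_test M e p1 Wu Wv). Qed.
Let Wphi : W01p Omega p phi. Proof. exact: W01p_picone_test. Qed.

Lemma local_term_le : (\int[mu]_(x in Omega) (dotv (finsler_field p H (wgrad v x))
  (wgrad phi x))%:E <= Ea)%E.
Proof.
have mgphi : measurable_fun setT (wgrad phi) by have [[_ [g /measurable_wgrad]]] := Wphi.
apply: ae_le_integral => //.
- apply: measurable_funTS; apply/measurable_EFinP; apply: measurable_dotv => //.
  exact: (measurableT_comp (measurable_finsler_field FH p1) mgv).
- apply: measurable_funTS; apply/measurable_EFinP; apply: (measurableT_comp (measurable_powR _)).
  exact: (measurableT_comp (measurable_finsler FH) mgu).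
- apply: ae_imp (wgrad_picone_test p1 M0 e0 Wu Wv uM v0) => x [w0 ->] _.
  by rewrite lee_fin; exact: finsler_picone.
Qed.

(** The differences of [v] and of [v + e] are the same, so that [discrete_picone]
    applies with the positive numbers [v x + e] and [v y + e]. *)
Lemma nonlocal_term_le : (\int[mu \x mu]_z (signed_pow p (v z.1 - v z.2) * (phi z.1 - phi z.2)
   * frac_kernel p s z)%:E <= Eb)%E.
Proof.
have m1 (f : 'rV[R]_n -> R) : measurable_fun setT f ->
    measurable_fun setT (fun z : 'rV[R]_n * 'rV[R]_n => f z.1 - f z.2).
  move=> mf; apply: measurable_funB; first exact: (measurableT_comp mf measurable_fst).
  exact: (measurableT_comp mf measurable_snd).
apply: ae_le_integral => //.
- apply/measurable_EFinP; apply: measurable_funM; last exact: measurable_frac_kernel.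
  apply: measurable_funM; last exact: m1.
  exact: (measurableT_comp (measurable_signed_pow p) (m1 _ v_meas)).
- apply/measurable_EFinP; apply: measurable_funM; last exact: measurable_frac_kernel.
  apply: (measurableT_comp (measurable_powR _)).
  by apply: measurableT_comp => //; exact: m1.
- have A := ae_picone_test p e uM v0.
  apply: ae_imp (ae_and (ae_prod1 mu A) (ae_prod2 mu A)) => -[x y] /= [[ux vx hx] [uy vy hy]] _.
  rewrite lee_fin ler_wpM2r ?frac_kernel_ge0// /phi hx hy /shift_powR.
  have -> : v x - v y = (v x + e) - (v y + e) by ring.
  have /andP[ux0 _] := ux; have /andP[uy0 _] := uy.
  by apply: discrete_picone => //; exact: ltr_wpDl.
Qed.

(** In the inequality for [v], the right-hand side is nonnegative and the first
    two terms are at most the energies of [u]. *)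
Lemma reaction_term_le : (\int[mu]_(x in Omega) (g1 x * signed_pow p (v x) *
  phi x)%:E <= Ea + Eb)%E.
Proof.
have [_ sup] := v_super.
have phi0 : {ae mu, forall x, 0 <= phi x}.
  by apply: nearW => x; exact: picone_test_ge0.
have := sup phi Wphi phi0.
have h0 : (0 <= \int[mu]_(x in Omega) (g2 x * phi x)%:E)%E.
  apply: ae_integral_ge0 => //.
    by apply/measurable_EFinP; apply: measurable_funM => //; exact: measurable_funTS.
  apply: ae_imp g2_ge0 => x h Ox; rewrite lee_fin mulr_ge0 ?h//; exact: picone_test_ge0.
move=> h; apply: le_of_sube_ge0; apply: (le_trans h0); apply: (le_trans h).
by apply: leeB => //; apply: leeD; [exact: local_term_le|exact: nonlocal_term_le].
Qed.

End test.

(** Dominated convergence in [reaction_term_le] when [e] tends to [0]. *)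
Lemma energy_ge0 : (0 <= energy Omega p s H g1 u)%E.
Proof.
have [G [G0 g1G]] := Lp_on_bounded g1_Loo.
pose f_ (k : nat) x := (g1 x * signed_pow p (v x) * picone_test p M (harmonic k) u v x)%:E.
pose f x := (g1 x * u x `^ p)%:E.
have good : {ae mu, forall x, Omega x -> [/\ 0 <= u x, 0 < v x, `|g1 x| <= G &
    forall k, picone_test p M (harmonic k) u v x = u x `^ p * shift_powR p (harmonic k) (v x)]}.
  apply: ae_imp (ae_and (ae_and uM v0) (ae_and g1G v_gt0)) => x [[ux vx] [gx vp]] Ox.
  split; [by case/andP: ux|exact: vp|exact: gx|move=> k].
  by rewrite /picone_test clamp_id// max_l.
have mup : measurable_fun setT (fun x => u x `^ p).
  exact: (measurableT_comp (measurable_powR _) u_meas).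
have [] := @dominated_convergence _ _ R mu Omega mO f_ f (fun x => (G * `|u x| `^ p)%:E).
- move=> k; apply/measurable_EFinP; apply: measurable_funM; last first.
    apply: measurable_funTS; exact: (measurable_picone_test M _ p1 Wu Wv).
  apply: measurable_funM => //; apply: measurable_funTS.
  exact: (measurableT_comp (measurable_signed_pow p) v_meas).
- by apply/measurable_EFinP; apply: measurable_funM => //; exact: measurable_funTS.
- apply: ae_imp good => x h Ox; have [ux vx _ hk] := h Ox.
  apply: cvg_EFin; first by near=> k.
  have -> : fine \o f_ ^~ x = fun k => g1 x * signed_pow p (v x) * (u x `^ p *
    (v x + harmonic k) `^ (1 - p)).
    by apply/funext => k; rewrite /= hk.
  have -> : g1 x * u x `^ p = g1 x * signed_pow p (v x) * (u x `^ p * (v x + 0) `^ (1 - p)).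
    rewrite signed_powE// addr0 mulrACA -powRD ?(gt_eqF vx) ?implybT//.
    by rewrite addrC subrKA subrr powRr0 mulr1.
  apply: cvgMr; apply: cvgMr.
  have vc : v x + harmonic k @[k --> \oo] --> v x + (0 : R).
    by apply: cvgD; [exact: cvg_cst|exact: cvg_harmonic].
  apply: (@cvg_comp _ _ _ (fun k => v x + harmonic k) (fun y : R => y `^ (1 - p)) _ _ _ vc).
  by apply: powR_continuous_pos; rewrite addr0.
- have Lu : u \in Lfun mu p%:E by have [[]] := Wu; rewrite Lp_onT.
  have [_ iu] := (Lfun_powP mu u p1').1 Lu.
  have := integrableZl mO G (@integrableS _ _ _ mu setT Omega _ measurableT mO (@subsetT _ _) iu).
  by [].
- apply: ae_imp good => x h k Ox; have [ux vx gG hk] := h Ox.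
  rewrite lee_fin hk (signed_powE _ vx) !normrM -mulrA ler_pM ?mulr_ge0//.
  rewrite mulrCA (ger0_norm (powR_ge0 _ _)) (ger0_norm ux) ler_piMr ?powR_ge0//.
  rewrite !ger0_norm ?powR_ge0// /shift_powR.
  have -> : 1 - p = - (p - 1) by rewrite opprB.
  rewrite powRN ler_pdivrMr ?mul1r; last by rewrite powR_gt0// ltr_wpDr// ?invr_ge0// ltW//
    harmonic_gt0.
  by rewrite powR_mono ?(ltW pm)// ?(ltW vx)// lerDl ltW// harmonic_gt0.
move=> fi _ cvf.
have lim_le : (\int[mu]_(x in Omega) f x <= Ea + Eb)%E.
  rewrite -(cvg_lim _ cvf)//; apply: lime_le; first by apply/cvg_ex; eexists; exact: cvf.
  by apply: nearW => k; apply: reaction_term_le; exact: harmonic_gt0.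
rewrite /energy -/Ea -/Eb sube_ge0//.
by rewrite (integrable_fin_num mO fi).
Unshelve. all: by end_near. Qed.

End estimate.

Theorem theorem2p28 (R : realType) (N : nat) (Omega : set 'rV[R]_N) (p s : R)
    (H g1 g2 : 'rV[R]_N -> R)
    (N2 : (2 <= N)%N) (dom : bounded_C1_domain Omega)
    (p1 : 1 < p) (s0 : 0 < s) (s1 : s < 1)
    (FH : finsler_minkowski H)
    (g1_ge0 : {ae lebesgue_rV N, forall x, Omega x -> 0 <= g1 x})
    (g1_Loo : Lp_on Omega +oo%E g1)
    (g2_ge0 : {ae lebesgue_rV N, forall x, Omega x -> 0 <= g2 x})
    (g2_Lq : Lp_on Omega (p / (p - 1))%:E g2)
    (energy_lt0 : exists u : 'rV[R]_N -> R,
      [/\ W01p Omega p u, Lp_on Omega +oo%E u,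
          {ae lebesgue_rV N, forall x, Omega x -> 0 <= u x} &
          (energy Omega p s H g1 u < 0)%E]) :
  ~ exists v : 'rV[R]_N -> R,
      weak_supersolution Omega p s H g1 g2 v /\ ae_positive Omega v.
Proof.
have [_ oO _ _ _] := dom; have mO := open_measurable_rV oO.
have [u [Wu Loo_u u_ge0 Elt0]] := energy_lt0.
move=> [v [sv v_gt0]].
have [M [M0 uM]] := Lp_on_bounded Loo_u.
have uM' : {ae lebesgue_rV N, forall x, 0 <= u x <= M}.
  apply: ae_imp (ae_and (ae_and uM u_ge0) (proj2 Wu)) => x [[h1 h2] h3].
  have [Ox|nOx] := pselect (Omega x); last by rewrite h3// lexx.
  by rewrite h2//= (le_trans (ler_norm _) (h1 Ox)).
have v0 : {ae lebesgue_rV N, forall x, 0 <= v x}.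
  apply: ae_imp (ae_and v_gt0 (proj2 (proj1 sv))) => x [h1 h2].
  have [Ox|nOx] := pselect (Omega x); last by rewrite h2.
  exact/ltW/h1.
have mg2 := Lp_on_measurable mO g2_Lq.
have := energy_ge0 p1 oO FH g1_Loo mg2 g2_ge0 M0 Wu uM' sv v0 v_gt0.
by rewrite leNgt Elt0.
Qed.
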